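(* Let $\mu$ be a finite measure on a countably generated measurable space $(\mathbb{X},\mathcal{X})$, and let $\mathrm{NPD}$ be the probability measure on $(\mathbb{X}^{\mathbb{Z}},\mathcal{X}^{\mathbb{Z}})$ whose $n$-dimensional densities with respect to $\mu^n$ are $\mathrm{NPD}_\mu(x_{1:n})$. Then $\mathrm{NPD}$ is universal with respect to $\mu$: for every $P\in\mathbb{E}(\mu)$, $\lim_n[-\log\mathrm{NPD}_\mu(X_{1:n})]/n=h_\mu$ $P$-a.s., $\lim_n\mathbb{E}[-\log\mathrm{NPD}_\mu(X_{1:n})]/n=h_\mu$, and $[-\log\mathrm{NPD}_\mu(X_{1:n})]/n\to h_\mu$ in $P$-probability.
   Context: On $(\mathbb{X}^{\mathbb{Z}},\mathcal{X}^{\mathbb{Z}})$, $X_k$ are coordinate maps, $x_{j:k}=(x_j,\dots,x_k)$; for a probability measure $P$, $P_n(A)=P(X_{1:n}\in A)$ and $P_\mu=dP_n/d\mu^n$ if $P_n\ll\mu^n$. $\mathbb{E}$: shift-stationary ergodic probability measures. For $P\in\mathbb{E}$ with $P_n\ll\mu^n$: $h_\mu(n)=\mathbb{E}[-\log P_\mu(X_{1:n})]$, $h_\mu=\lim_n h_\mu(n)/n$; $\mathbb{E}(\mu)=\{P\in\mathbb{E}:P_n\ll\mu^n\ \forall n,\ |h_\mu|<\infty\}$; expectations and ''a.s.'' refer to $P$. NPD density: fix finite $\sigma$-fields $\mathcal{X}_0\subset\mathcal{X}_1\subset\cdots\subset\mathcal{X}$ with $\mathcal{X}_0=\{\emptyset,\mathbb{X}\}$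 and $\sigma(\bigcup_l\mathcal{X}_l)=\mathcal{X}$; let $\chi_l$ be the finite partition generating $\mathcal{X}_l$. For $x\in\mathbb{X}$ let $x^l$ be the cell $A\in\chi_l$ with $x\in A$, $x^l_{1:n}=(x^l_1,\dots,x^l_n)$. Treat $\chi_l$ as a finite alphabet and let $R^l$ be a probability measure on $\chi_l^{\mathbb{Z}}$ universal with respect to the alphabet $\chi_l$ (for every stationary ergodic process $(Y_i)$ over $\chi_l$ with Shannon entropy rate $H$, $-\frac1n\log R^l(Y_{1:n})\to H$ a.s., in expectation and in probability), $R^l(a_{1:n})$ the cylinder probability. $\mathrm{NPD}^l_\mu(x_{1:n})=R^l(x^l_{1:n})/\prod_{i=1}^n\mu(x_i^l)$, $\mathrm{NPD}_\mu(x_{1:n})=\sum_{l\ge0}w_l\mathrm{NPD}^l_\mu(x_{1:n})$, $w_l=\frac1{l+1}-\frac1{l+2}$. (These densities are consistent and define a probability measure $\mathrm{NPD}$.) *)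

(* Defs.v *)
From HB Require Import structures.
From mathcomp Require Import all_boot all_order all_algebra.
From mathcomp Require Import all_classical all_reals all_analysis measurable_realfun.
Set Implicit Arguments. Unset Strict Implicit. Unset Printing Implicit Defensive.
Import Order.TTheory GRing.Theory Num.Theory numFieldNormedType.Exports.
Local Open Scope classical_set_scope.
Local Open Scope ring_scope.

HB.instance Definition _ (m : nat) := isPointed.Build 'I_m.+1 ord0.

Definition cylgen (A : Type) (measA : set (set A)) : set (set (int -> A)) :=
  [set C | exists (i : int) (B : set A), measA B /\ C = (fun w => w i) @^-1` B].

Definition pathT (A : pointedType) (measA : set (set A)) :=
  g_sigma_algebraType (cylgen measA).

Definition shift (A : Type) (w : int -> A) : int -> A := fun i => w (i + 1)%R.

Definition stationary (R : realType) (A : pointedType) (measA : set (set A))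
  (Q : probability (pathT measA) R) : Prop :=
  forall B : set (pathT measA), measurable B -> Q (@shift A @^-1` B) = Q B.

Definition ergodic (R : realType) (A : pointedType) (measA : set (set A))
  (Q : probability (pathT measA) R) : Prop :=
  forall B : set (pathT measA), measurable B -> @shift A @^-1` B = B ->
    Q B = 0%E \/ Q B = 1%E.

Definition X1n (A : Type) (n : nat) (w : int -> A) : n.-tuple A :=
  [tuple w (Posz (val i).+1) | i < n].

Definition neglog (R : realType) (x : \bar R) : \bar R :=
  match x with
  | EFin r => if r == 0 then +oo%E else (- ln r)%:E
  | +oo%E => -oo%E
  | -oo%E => +oo%E
  end.

Definition conv_as (R : realType) d (S : measurableType d) (Q : probability S R)
  (f : nat -> S -> \bar R) (h : R) : Prop :=
  {ae Q, forall w, (fun n => f n w) @ \oo --> h%:E}.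

Definition conv_exp (R : realType) d (S : measurableType d) (Q : probability S R)
  (f : nat -> S -> \bar R) (h : R) : Prop :=
  (fun n => (\int[Q]_w f n w)%E) @ \oo --> h%:E.

Definition conv_prob (R : realType) d (S : measurableType d) (Q : probability S R)
  (f : nat -> S -> \bar R) (h : R) : Prop :=
  forall eps : R, 0 < eps ->
    (fun n => Q [set w | (eps%:E <= `|f n w - h%:E|)%E]) @ \oo --> 0%E.

Definition nlog (R : realType) (n : nat) (x : \bar R) : \bar R :=
  ((n%:R)^-1%:E * neglog x)%E.

Definition apath (m : nat) := pathT (@setT (set 'I_m.+1)).

Definition cylP (R : realType) (m : nat) (Q : probability (apath m) R)
  (n : nat) (a : n.-tuple 'I_m.+1) : \bar R :=
  Q [set w : apath m | X1n n w = a].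

Definition block_entropy (R : realType) (m : nat) (Q : probability (apath m) R)
  (n : nat) : R :=
  - \sum_(a : n.-tuple 'I_m.+1) fine (cylP Q a) * ln (fine (cylP Q a)).

Definition entropy_rate (R : realType) (m : nat) (Q : probability (apath m) R)
  (H : R) : Prop :=
  (fun n : nat => (n%:R)^-1 * block_entropy Q n) @ \oo --> H.

Definition universal_alphabet (R : realType) (m : nat) (Rm : probability (apath m) R)
  : Prop :=
  forall (Q : probability (apath m) R) (H : R),
    stationary Q -> ergodic Q -> entropy_rate Q H ->
    let f := fun n (w : apath m) => nlog n (cylP Rm (X1n n w)) in
    [/\ conv_as Q f H, conv_exp Q f H & conv_prob Q f H].

(* integral of g w.r.t. the n-fold product mu^n (iterated integrals) *)
Fixpoint iint (R : realType) d (T : measurableType d) (mu : {measure set T -> \bar R})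
  (n : nat) : (n.-tuple T -> \bar R) -> \bar R :=
  match n return (n.-tuple T -> \bar R) -> \bar R with
  | 0 => fun g => g [tuple]
  | n'.+1 => fun g => (\int[mu]_x iint mu (fun t : n'.-tuple T => g (cons_tuple x t)))%E
  end.

Definition Xpath d (T : measurableType d) := pathT (@measurable d T).

Definition is_density (R : realType) d (T : measurableType d)
  (mu : {measure set T -> \bar R}) (P : probability (Xpath T) R) (n : nat)
  (f : n.-tuple T -> \bar R) : Prop :=
  [/\ forall t, (0 <= f t)%E,
      @measurable_fun _ _ (n.-tuple T) (\bar R) setT f &
      forall A : set (n.-tuple T), measurable A ->
        P [set w : Xpath T | A (X1n n w)] = iint mu (fun t => (\1_A t)%:E * f t)%E].

Definition in_E_mu (R : realType) d (T : measurableType d)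
  (mu : {measure set T -> \bar R}) (P : probability (Xpath T) R)
  (p : forall n, n.-tuple T -> \bar R) (h : R) : Prop :=
  [/\ stationary P, ergodic P, forall n, is_density mu P (p n) &
      (fun n => ((n%:R)^-1%:E * \int[P]_w neglog (p n (X1n n w)))%E) @ \oo --> h%:E].

(* cell l : T -> 'I_(k l).+1 labels the cells of the finite partition chi_l *)
Definition finite_filtration d (T : measurableType d) (k : nat -> nat)
  (cell : forall l, T -> 'I_(k l).+1) : Prop :=
  [/\ k 0 = 0%N,                                          (* chi_0 = {X} *)
      forall l a, exists x, cell l x = a,
      forall l a, measurable (cell l @^-1` [set a]),
      forall l x y, cell l.+1 x = cell l.+1 y -> cell l x = cell l y
                                                          (* X_l subset X_(l+1) *) &
      forall A : set T, measurable A <->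
        <<s [set C | exists l a, C = cell l @^-1` [set a]] >> A
                                                          (* sigma(U X_l) = X *)].

Definition wNPD (R : realType) (l : nat) : R := (l.+1%:R)^-1 - (l.+2%:R)^-1.

Definition NPDl (R : realType) d (T : measurableType d) (mu : {measure set T -> \bar R})
  (k : nat -> nat) (cell : forall l, T -> 'I_(k l).+1)
  (Rl : forall l, probability (apath (k l)) R) (l n : nat) (x : n.-tuple T) : R :=
  fine (cylP (Rl l) (map_tuple (cell l) x)) /
    \prod_(i < n) fine (mu (cell l @^-1` [set cell l (tnth x i)])).
Arguments NPDl {R d T} mu k cell Rl l {n} x.

Definition NPD (R : realType) d (T : measurableType d) (mu : {measure set T -> \bar R})
  (k : nat -> nat) (cell : forall l, T -> 'I_(k l).+1)
  (Rl : forall l, probability (apath (k l)) R) (n : nat) (x : n.-tuple T) : \bar R :=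
  (\sum_(0 <= l <oo) (wNPD R l * NPDl mu k cell Rl l x)%:E)%E.
Arguments NPD {R d T} mu k cell Rl {n} x.

(* Main.v *)
(**
The proof has two halves; neither uses the Shannon-McMillan-Breiman theorem.

Lower bound.  Let [q] be a family of subdensities and suppose that
[q_m(X_{1:m}) >= exp(- m c)] infinitely often with positive probability, for some
[c < h].  By ergodicity almost every orbit meets such an exceptional block over and
over, so a greedy parsing covers a proportion close to 1 of [1..N] by exceptional
blocks.  Summing over all parsings of a word into single letters and blocks, with
weights of total mass at most 1, yields a subdensity [r_N] (a renewal mixture)
which is large along the greedy parsing.  Gibbs' inequality [E ln r_N <= E ln p_N]
then forces the entropy rate below [h], a contradiction.  The same greedy covering
gives the limsup half of Birkhoff's theorem.

Upper bound.  [NPD >= w_l NPD^l].  The process quantized at level [l] has an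
entropy rate [H_l] (Fekete), so universality of [R^l] together with the limsup bound
for the averages of [ln mu(X_i^l)] bounds the limsup by [H_l + E ln mu(X_1^l)].  This
quantity is close to [h] for a suitable [l]: take [n] with [h_mu(n)/n] close to [h],
approximate the clipped function [- ln p_n] in L^1(P_n + mu^n) by a function of the
cells, and use it as test function in the Donsker-Varadhan inequality.

Convergence in mean uses the same upper bound and, for the lower bound, Gibbs'
inequality.
*)
Require Import Defs.
From HB Require Import structures.
From mathcomp Require Import all_boot all_order all_algebra.
From mathcomp Require Import all_classical all_reals all_analysis measurable_realfun.
From mathcomp Require Import ring lra zify.
Set Implicit Arguments. Unset Strict Implicit. Unset Printing Implicit Defensive.
Import Order.TTheory GRing.Theory Num.Theory numFieldNormedType.Exports.
Import Defs.
Local Open Scope classical_set_scope.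
Local Open Scope ring_scope.

(** * Powers of a finite measure, densities and path space *)

Section product_power.
Context (R : realType) d (T : measurableType d) (mu : {finite_measure set T -> \bar R}).
Local Open Scope ereal_scope.

(** Only the mean entropy rate of [P] is given; [- ln p_n / n] is not known to converge along
    orbits, so [NPD] cannot be compared with [p_n] pointwise. The lower bound must turn an event of
    positive probability into a statement about means, and Gibbs' inequality needs one subdensity
    fixed in advance for all orbits. The positions of the exceptional blocks are unknown, hence the
    mixture over all parsings. Its price must be small compared with [h - c]: letters follow the
    uniform density, discounted by [exp(- delta)], and the mass thus freed is divided among the
    block lengths with weights of order [1 / m^2], whose logarithmic cost is negligible for long
    blocks. In the upper bound the obstacle is the order of the limits in [n] and [l]. An entropy
    rate is the infimum of the block entropies per letter, so a single [n] suffices and only [l] has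
    to be chosen. The ideal test function [ln p_n] may be unbounded; clipping it costs little
    because its mean is finite and [mu] has finite mass. *)

Definition tcons n (z : T * n.-tuple T) : n.+1.-tuple T := cons_tuple z.1 z.2.

Lemma measurable_tcons n : measurable_fun setT (@tcons n).
Proof.
have := @measurable_cons _ _ (T * n.-tuple T)%type T fst n snd measurable_fst measurable_snd.
congr measurable_fun; apply/funext => z; exact/val_inj.
Qed.

HB.instance Definition _ n := isMeasurableFun.Build _ _ _ _ (@tcons n) (@measurable_tcons n).

Section step.
Variables (n : nat) (nu : {finite_measure set (n.-tuple T) -> \bar R}).

Definition mupowS : set (n.+1.-tuple T) -> \bar R := pushforward (mu \x nu) (@tcons n).

Let mupowS0 : mupowS set0 = 0.
Proof. by rewrite /mupowS /pushforward preimage_set0 measure0. Qed.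

Let mupowS_ge0 A : 0 <= mupowS A. Proof. exact: measure_ge0. Qed.

Let mupowS_sigma_additive : semi_sigma_additive mupowS.
Proof. by apply: measure_semi_sigma_additive; exact: measurable_tcons. Qed.

HB.instance Definition _ := isMeasure.Build _ _ _ mupowS
  mupowS0 mupowS_ge0 mupowS_sigma_additive.

Let mupowS_fin : fin_num_fun mupowS.
Proof.
have fT : mupowS setT < +oo.
  rewrite /mupowS /pushforward preimage_setT -setXTT product_measure1E//.
  by apply: lte_mul_pinfty => //; rewrite ?fin_num_measure// ltey_eq fin_num_measure.
move=> A mA; rewrite ge0_fin_numE//; apply: le_lt_trans fT.
by apply: le_measure; rewrite ?inE.
Qed.

HB.instance Definition _ := @Measure_isFinite.Build _ _ _ mupowS mupowS_fin.

End step.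

(** [iint] is only an iterated integral; as the integral of a finite measure it inherits linearity,
    monotonicity and Fubini's theorem. The new coordinate is put in front, in the order in which
    [iint] integrates. *)
Fixpoint mupow n : {finite_measure set (n.-tuple T) -> \bar R} :=
  match n with 0%N => (dirac ([tuple] : 0.-tuple T)) | n'.+1 => (mupowS (mupow n')) end.

Lemma iintE n (f : n.-tuple T -> \bar R) : (forall t, 0 <= f t) -> measurable_fun setT f ->
  iint mu f = \int[mupow n]_t f t.
Proof.
elim: n f => [|n IH] f f0 mf /=.
  by rewrite integral_dirac// diracT mul1e.
have mf2 : measurable_fun setT (f \o @tcons n).
  by apply: measurableT_comp => //; exact: measurable_tcons.
rewrite ge0_integral_pushforward//=.
rewrite preimage_setT fubini_tonelli1//.
apply: eq_integral => x _; rewrite IH//.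
have := measurableT_comp mf2 (pair1_measurable x).
exact.
Qed.

End product_power.

Section cvge_near.
Context (R : realType) (I : Type) (F : set_system I) {FF : Filter F}.
Local Open Scope ereal_scope.

Lemma cvge_near_gt (u : I -> \bar R) l a : u x @[x --> F] --> l -> a < l ->
  \forall x \near F, a < u x.
Proof.
by move=> ul al; apply: (ul [set y | a < y]); apply: open_nbhs_nbhs; split => //; exact: open_ereal_gt_ereal.
Qed.

Lemma cvge_near_lt (u : I -> \bar R) l a : u x @[x --> F] --> l -> l < a ->
  \forall x \near F, u x < a.
Proof.
by move=> ul al; apply: (ul [set y | y < a]); apply: open_nbhs_nbhs; split => //; exact: open_ereal_lt_ereal.
Qed.

End cvge_near.

Section cvge_le.
Context (R : realType) (I : Type) (F : set_system I) {FF : ProperFilter F}.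
Local Open Scope ereal_scope.

Lemma cvge_near_le (u : I -> \bar R) l a : u x @[x --> F] --> l ->
  (\forall x \near F, u x <= a) -> l <= a.
Proof.
move=> ul ua; rewrite leNgt; apply/negP => /(cvge_near_gt ul) H.
by have [x [+ h]] := filter_ex (filterI H ua); rewrite ltNge h.
Qed.

Lemma cvge_near_ge (u : I -> \bar R) l a : u x @[x --> F] --> l ->
  (\forall x \near F, a <= u x) -> a <= l.
Proof.
move=> ul ua; rewrite leNgt; apply/negP => /(cvge_near_lt ul) H.
by have [x [+ h]] := filter_ex (filterI H ua); rewrite ltNge h.
Qed.

End cvge_le.

Section density.
Context (R : realType) d (T : measurableType d).
Variables (m nu : {measure set T -> \bar R}) (p : T -> \bar R).
Hypotheses (p0 : forall t, (0 <= p t)%E) (mp : measurable_fun setT p).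
Hypothesis mE : forall A, measurable A -> m A = (\int[nu]_t ((\1_A t)%:E * p t))%E.
Local Open Scope ereal_scope.

Import HBNNSimple.

Lemma ge0_integral_density (f : T -> \bar R) : measurable_fun setT f ->
  (forall t, 0 <= f t) -> \int[m]_t f t = \int[nu]_t (f t * p t).
Proof.
move=> mf f0; pose f_ := nnsfun_approx (@measurableT _ T) mf.
have f_cvg t : EFin \o f_ ^~ t @ \oo --> f t by exact: cvg_nnsfun_approx.
have f_nd t : nondecreasing_seq (EFin \o f_ ^~ t).
  by move=> a b ab; rewrite lee_fin; exact/lefP/nd_nnsfun_approx.
transitivity (limn (fun n => \int[m]_t (f_ n t)%:E)).
  rewrite -monotone_convergence//.
  - by apply: eq_integral => y _; apply/esym/cvg_lim => //; exact: f_cvg.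
  - by move=> n; exact/measurable_EFinP/measurable_funP.
  - by move=> n y _; rewrite lee_fin.
  - by move=> t _; exact: f_nd.
rewrite [X in limn X](_ : _ = (fun n => \int[nu]_t ((f_ n t)%:E * p t))).
  rewrite -monotone_convergence//; last 3 first.
    - by move=> n; apply: emeasurable_funM => //; exact/measurable_EFinP/measurable_funP.
    - by move=> n t _; rewrite mule_ge0// lee_fin.
    - by move=> t _ a b ab; rewrite lee_wpmul2r//; exact: f_nd.
  apply: eq_integral => t _; apply/cvg_lim => //.
  (* Multiplication by [+oo] is not continuous at 0. Where [p t = +oo], either [f t = 0] and all
     approximants vanish, or [0 < f t] and they are eventually positive. *)
  have [pt|pt] := eqVneq (p t) +oo; last first.
    have pf : p t \is a fin_num by rewrite ge0_fin_numE// ltey.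
    by apply: cvgeMr => //; exact: f_cvg.
  have [ft|ft] := eqVneq (f t) 0.
    rewrite ft mul0e.
    apply: cvg_near_cst; apply: nearW => n.
    have : (f_ n t)%:E <= f t.
      by rewrite nnsfun_approxE; exact: le_approx.
    rewrite ft lee_fin => h.
    by rewrite (_ : f_ n t = 0%R) ?mul0e//; apply/eqP; rewrite eq_le h /=.
  have ft0 : 0 < f t by rewrite lt_neqAle eq_sym ft f0.
  rewrite pt gt0_muley//.
  apply: cvg_near_cst.
  have : \forall n \near \oo, 0 < (f_ n t)%:E.
    exact: cvge_near_gt (f_cvg t) ft0.
  by apply: filterS => n h; rewrite gt0_muley.
apply/funext => n.
transitivity (\sum_(k \in range (f_ n)) (k%:E * m (f_ n @^-1` [set k]))).
  by rewrite integralT_nnsfun sintegralE.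
transitivity (\sum_(k \in range (f_ n))
    \int[nu]_t ((k * \1_(f_ n @^-1` [set k]) t)%:E * p t)).
  apply: eq_fsbigr => r; rewrite inE => -[x _ <-]. rewrite mE// -ge0_integralZl_EFin//.
  - by apply: eq_integral => t _; rewrite EFinM muleA.
  - by move=> t _; rewrite mule_ge0// lee_fin.
  - by apply: emeasurable_funM => //; exact/measurable_EFinP.
rewrite -ge0_integral_fsum//.
- apply: eq_integral => t _; rewrite -ge0_mule_fsuml; last by move=> i; rewrite nnfun_muleindic_ge0.
  by rewrite fsumEFin// -fimfunE.
- by move=> r; apply: emeasurable_funM => //; exact/measurable_EFinP/measurable_funM.
- by move=> r x _; rewrite mule_ge0// nnfun_muleindic_ge0.
Qed.

End density.

(** * Shifts and coordinates on path space *)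

Section path_space.
Variables (A : pointedType) (measA : set (set A)).

Lemma measurable_coord (i : int) (B : set A) : measA B ->
  measurable ([set w | B (w i)] : set (pathT measA)).
Proof. by move=> mB; apply: sub_sigma_algebra; exists i, B. Qed.

Lemma measurable_to_path d (S : measurableType d) (f : S -> pathT measA) :
  (forall i B, measA B -> measurable (f @^-1` [set w | B (w i)])) ->
  measurable_fun setT f.
Proof.
move=> mf _ B mB; rewrite setTI; move: B mB.
apply: (@smallest_sub _ _ _ [set B | measurable (f @^-1` B)]).
  split => [|B /= mB|F mF /=]; first by rewrite /= preimage_set0.
    by rewrite setTD preimage_setC; exact: measurableC.
  by rewrite preimage_bigcup; exact: bigcupT_measurable.
by move=> _ [i [B [mB ->]]]; exact: mf.
Qed.

Lemma measurable_shift : measurable_fun setT (@shift A : pathT measA -> pathT measA).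
Proof. by apply: measurable_to_path => i B mB; exact: measurable_coord. Qed.

Lemma measurable_iter_shift n :
  measurable_fun setT (iter n (@shift A) : pathT measA -> pathT measA).
Proof.
elim: n => [|n IH]; first exact: measurable_id.
exact: (measurableT_comp measurable_shift IH).
Qed.

Lemma iter_shiftE n (w : int -> A) i : iter n (@shift A) w i = w (i + n%:Z).
Proof.
elim: n i => [|n IH] i /=; first by rewrite addr0.
by rewrite /shift IH -addrA; congr (w (i + _)); rewrite -PoszD add1n.
Qed.

Section stationarity.
Variables (R : realType) (Q : probability (pathT measA) R).
Hypothesis stQ : stationary Q.

Lemma stationary_iter n (B : set (pathT measA)) : measurable B ->
  Q (iter n (@shift A) @^-1` B) = Q B.
Proof.
move=> mB; elim: n => [|n IH] //.
transitivity (Q (iter n (@shift A) @^-1` (@shift A @^-1` B))); first by [].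
rewrite -IH.
have mB' : measurable (iter n (@shift A) @^-1` B : set (pathT measA)).
  by rewrite -[X in measurable X]setTI; exact: measurable_iter_shift.
rewrite -(stQ mB'); congr (Q _); apply/funext => w /=; congr (B _).
by rewrite -iterS -iterSr.
Qed.

Lemma stationary_integral n (f : pathT measA -> \bar R) : measurable_fun setT f ->
  (forall w, 0 <= f w)%E -> (\int[Q]_w f (iter n (@shift A) w) = \int[Q]_w f w)%E.
Proof.
move=> mf f0; have mS := measurable_iter_shift n.
have := @ge0_integral_pushforward _ _ _ _ _ _ mS Q setT f measurableT mf.
rewrite preimage_setT => <-; last by move=> ? _; exact: f0.
by apply: eq_measure_integral => B mB _; exact: stationary_iter.
Qed.

End stationarity.

End path_space.

Lemma tnth_X1n (A : Type) n (w : int -> A) i : tnth (X1n n w) i = w (Posz i.+1).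
Proof. by rewrite tnth_mktuple. Qed.

Lemma X1n_cat (A : pointedType) m N (w : int -> A) :
  X1n (N + m) w = X1n m w ++ X1n N (iter m (@shift A) w) :> seq A.
Proof.
apply: (@eq_from_nth _ (w 0)); first by rewrite size_cat !size_tuple addnC.
move=> i; rewrite size_tuple => iN; rewrite nth_cat size_tuple.
have nthX k (v : int -> A) j : (j < k)%N -> nth (w 0) (X1n k v) j = v (Posz j.+1).
  by move=> jk; rewrite -(tnth_nth _ (X1n k v) (Ordinal jk)) tnth_X1n.
rewrite nthX//; case: ltnP => im; first by rewrite nthX.
rewrite nthX; last by lia.
by rewrite iter_shiftE; congr w; lia.
Qed.

Lemma measurable_X1n d (T : measurableType d) n :
  measurable_fun setT (@X1n T n : Xpath T -> n.-tuple T).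
Proof.
apply/measurable_fun_tnthP => i _ B mB; rewrite setTI.
rewrite (_ : _ @^-1` _ = [set w : Xpath T | B (w (Posz i.+1))]); first exact: measurable_coord.
by apply/seteqP; split => w /=; rewrite tnth_X1n.
Qed.

Section neglog.
Context (R : realType).
Local Open Scope ereal_scope.

Lemma measurable_neglog : measurable_fun setT (@neglog R).
Proof.
rewrite (_ : @neglog R = fun y => if y == +oo then -oo else
   if (y == -oo) || (y == 0) then +oo else (- ln (fine y))%:E); last first.
  by apply/funext => -[r| |] //=; rewrite eqe.
have me c : measurable_fun setT (fun y : \bar R => y == c).
  exact: measurable_fun_eqe.
apply: measurable_fun_ifT => //; apply: measurable_fun_ifT => //.
  exact: measurable_or.
apply/measurable_EFinP; apply: measurableT_comp => //.
apply: measurableT_comp; first exact: measurable_ln.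
exact: fine_measurable.
Qed.

End neglog.

(** Positive and negative parts are compared separately. If the right-hand side is [+oo - +oo],
    which is [-oo], then the negative part of [f] has infinite integral too and both sides are
    [-oo]. *)
Lemma le_integral_ae d (T : measurableType d) (R : realType) (m : {measure set T -> \bar R})
    (f g : T -> \bar R) : measurable_fun setT f -> measurable_fun setT g ->
  {ae m, forall t, f t <= g t}%E -> (\int[m]_t f t <= \int[m]_t g t)%E.
Proof.
move=> mf mg fg; rewrite integralE [leRHS]integralE; apply: leeB.
  apply: ae_ge0_le_integral => //; try exact: measurable_funepos.
  apply: filterS fg => t + _; rewrite !funeposE => h.
  by rewrite ge_max !le_max lexx h orbT.
apply: ae_ge0_le_integral => //; try exact: measurable_funeneg.
apply: filterS fg => t + _; rewrite !funenegE => h.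
by rewrite ge_max !le_max lexx leeN2 h orbT.
Qed.

(** A named copy of [X1n] with its domain fixed to [Xpath T], to which the measurable-function
    instance is attached so that [distribution] applies. *)
Definition block d (T : measurableType d) n : Xpath T -> n.-tuple T := @X1n T n.

HB.instance Definition _ d (T : measurableType d) n :=
  isMeasurableFun.Build _ _ (Xpath T) (n.-tuple T) (@block d T n) (@measurable_X1n d T n).

(** * Gibbs' inequality for subdensities *)

Section gibbs.
Context (R : realType) d (T : measurableType d) (mu : {finite_measure set T -> \bar R}).
Context (P : probability (Xpath T) R) (n : nat) (p : n.-tuple T -> \bar R).
Hypothesis dP : is_density mu P p.
Local Open Scope ereal_scope.

Let p0 t : 0 <= p t. Proof. by case: dP. Qed.
Let mp : measurable_fun setT p. Proof. by case: dP. Qed.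

Lemma density_integral (g : n.-tuple T -> \bar R) : measurable_fun setT g ->
  (forall t, 0 <= g t) -> \int[P]_w g (X1n n w) = \int[mupow mu n]_t (g t * p t).
Proof.
move=> mg g0; rewrite -(ge0_integral_density (m := distribution P (@block d T n)))//.
  by rewrite ge0_integral_distribution.
move=> A mA; rewrite /distribution /pushforward.
case: dP => _ _ /(_ A mA).
move=> h; apply: (etrans h); rewrite iintE//; first by move=> t; rewrite mule_ge0.
by apply: emeasurable_funM => //; exact/measurable_EFinP.
Qed.

Lemma integral_density_eq1 : \int[mupow mu n]_t p t = 1.
Proof.
transitivity (\int[P]_w (cst 1 (X1n n w))).
  by rewrite density_integral//=; apply: eq_integral => t _; rewrite mul1e.
by rewrite integral_cst// mul1e; exact: probability_setT.
Qed.

Lemma measurable_fun_X1n (g : n.-tuple T -> \bar R) : measurable_fun setT g ->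
  measurable_fun setT (fun w : Xpath T => g (X1n n w)).
Proof. by move=> mg; exact: (measurableT_comp mg (@measurable_X1n d T n)). Qed.

(** With [u = r / p] the mean of [u] is at most the integral of [r], hence at most 1, and
    [ln x <= x - 1] gives [- ln p + (1 - u) <= - ln r] almost surely. The mean of [neglog r] is
    allowed to be [+oo]. *)
Lemma integral_neglog_le (r : n.-tuple T -> \bar R) :
  (forall t, 0 <= r t) -> measurable_fun setT r -> \int[mupow mu n]_t r t <= 1 ->
  P.-integrable setT (fun w => neglog (p (X1n n w))) ->
  \int[P]_w neglog (p (X1n n w)) <= \int[P]_w neglog (r (X1n n w)).
Proof.
move=> r0 mr r1 ip.
(* [0 `^ (-1) = 0] and [fine +oo = 0], hence [u t = 0] where [p t] is [0] or [+oo]. *)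
pose u t := r t * (fine (p t) `^ (-1))%:E.
have u0 t : 0 <= u t by rewrite mule_ge0// lee_fin powR_ge0.
have mu_ : measurable_fun setT u.
  apply: emeasurable_funM => //; apply/measurable_EFinP.
  have h := measurableT_comp (fine_measurable measurableT) mp.
  exact: (measurableT_comp (measurable_powR (-1)%R) h).
have up t : u t * p t <= r t.
  rewrite /u; move: (p0 t); case: (p t) => [s| |]//=; last first.
    by rewrite powR0 ?mule0 ?mul0e// oppr_eq0 oner_neq0.
  rewrite lee_fin le_eqVlt => /predU1P[<-|s0].
    by rewrite mule0.
  by rewrite -muleA -EFinM (powR_inv1 (ltW s0)) mulVf ?gt_eqF// mule1.
have Pu : \int[P]_w u (X1n n w) <= 1.
  rewrite density_integral//; apply: le_trans r1; apply: ge0_le_integral => //.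
    by move=> t _; rewrite mule_ge0.
  exact: emeasurable_funM.
have muX := measurable_fun_X1n mu_.
have iu : P.-integrable setT (fun w => u (X1n n w)).
  apply/integrableP; split => //.
  under eq_integral do rewrite gee0_abs//.
  by rewrite (le_lt_trans Pu)// ltry.
have i1 : P.-integrable setT (fun=> 1%:E) by exact: finite_measure_integrable_cst.
apply: (@le_trans _ _ (\int[P]_w (neglog (p (X1n n w)) + (1 - u (X1n n w))))).
  rewrite integralD//; last exact: integrableB.
  rewrite integralB// integral_cst//= mul1e probability_setT.
  rewrite leeDl// sube_ge0//.
  rewrite ge0_fin_numE ?(le_lt_trans Pu)// ?ltry//.
  by apply: integral_ge0.
apply: le_integral_ae.
- by apply: measurable_int (integrableD measurableT ip (integrableB measurableT i1 iu)).
- exact: (measurable_fun_X1n (measurableT_comp (@measurable_neglog R) mr)).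
(* Integrability of [neglog p] excludes almost surely the values 0 and [+oo] of [p], at which [u] is
   not the quotient [r / p]. *)
apply: filterS (integrable_ae measurableT ip) => w /(_ I).
move: (X1n n w) => t {w}; rewrite /u.
move: (p0 t); case: (p t) => [s| |]//=; rewrite lee_fin => s0.
case: eqP => // /eqP sn0 _.
have {s0 sn0} s0 : (0 < s)%R by rewrite lt_neqAle eq_sym sn0.
rewrite (powR_inv1 (ltW s0)).
move: (r0 t); case: (r t) => [x| |]//=; rewrite ?lee_fin => x0; last first.
  by rewrite gt0_mulye ?lte_fin ?invr_gt0//.
case: eqP => [->|/eqP xn0]; first by rewrite leey.
have {x0 xn0} x0 : (0 < x)%R by rewrite lt_neqAle eq_sym xn0.
rewrite -!EFinD lee_fin.
have := @le_ln1Dx R (x / s - 1).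
rewrite addrCA subrr addr0 lnM ?posrE ?invr_gt0// lnV ?posrE// => H.
suff : (ln x - ln s <= x / s - 1)%R by lra.
apply: H; rewrite ltrBrDl subrr; exact: divr_gt0.
Qed.

End gibbs.

(** * Greedy coverings of orbits *)

(* [lb N w b] abstracts "the score of the first [N] steps of the orbit of [w] is at least [b]":
   a single step costs at most [delta]. *)
Section greedy_covering.
Context (R : realType) (Omega : Type) (S : Omega -> Omega).
Variables (lb : nat -> Omega -> R -> Prop) (delta : R).
Hypothesis lb_le : forall N w b b', b' <= b -> lb N w b -> lb N w b'.
Hypothesis lb0 : forall w, lb 0%N w 0.
Hypothesis lbS : forall N w b, lb N (S w) b -> lb N.+1 w (b - delta).

Lemma lb_iter i N w b : lb N (iter i S w) b -> lb (N + i) w (b - delta * i%:R).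
Proof.
elim: i w b => [|i IH] w b; first by rewrite addn0 mulr0 subr0.
rewrite iterSr addnS => /IH /lbS; apply: lb_le.
by rewrite -natr1 mulrDr mulr1 opprD addrA.
Qed.

(** Read the orbit from left to right: outside [A] move by one letter, at a point of [A] jump over
    its block. A jump of length [m] skips at most [m] visits to [A], which its gain [kappa * m] pays
    for. A last block that does not fit is read letter by letter; fewer than [K] letters remain,
    whence the loss [kappa * K]. *)
Lemma lb_greedy (A : set Omega) (kappa : R) (K : nat) : 0 <= kappa -> 0 <= delta ->
  (forall w, A w -> exists m : nat, [/\ (0 < m <= K)%N &
     forall N b, lb N (iter m S w) b -> lb (N + m) w (b + kappa * m%:R)]) ->
  forall N w,
    lb N w (kappa * (\sum_(i < N) \1_A (iter i S w)) - delta * N%:R - kappa * K%:R).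
Proof.
move=> k0 d0 HA N; have [n] := ubnP N; elim: n N => // n IH [|N] /ltnSE Nn w.
  apply: lb_le (lb0 w); rewrite big_ord0 !mulr0 subr0 sub0r oppr_le0.
  exact: mulr_ge0.
have ind01 v : 0 <= (\1_A v : R) <= 1 by rewrite indicE; case: (_ \in _); rewrite /= ?ler01 ?lexx.
have sumle a b (F : nat -> Omega) : \sum_(a <= i < b) \1_A (F i) <= (b - a)%:R :> R.
  apply: (@le_trans _ _ (\sum_(a <= i < b) 1)); first by apply: ler_sum => i _; case/andP: (ind01 (F i)).
  by rewrite sumr_const_nat.
have [Aw|Aw] := pselect (A w); last first.
  rewrite big_ord_recl/= (_ : \1_A w = 0 :> R) ?add0r; last first.
    by rewrite indicE; case: (boolP (w \in A)) => // /set_mem.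
  rewrite (eq_bigr (fun i : 'I_N => \1_A (iter i S (S w)))) => [|i _]; last first.
    by rewrite add0n -iterSr.
  apply: lb_le (lbS (IH N Nn (S w))).
  by rewrite -natr1 mulrDr mulr1; lra.
have [m [/andP[m0 mK] Hm]] := HA w Aw.
have [mN|Nm] := leqP m N.+1.
  have mN' : (N.+1 - m < n)%N by lia.
  have := Hm _ _ (IH _ mN' (iter m S w)).
  rewrite subnK//; apply: lb_le.
  rewrite -(big_mkord xpredT (fun i => \1_A (iter i S w) : R)).
  rewrite (@big_cat_nat _ _ _ m)//=.
  rewrite -(big_mkord xpredT (fun i => \1_A (iter i S (iter m S w)) : R)).
  rewrite -{2}[m]add0n big_addn.
  rewrite [X in _ * (_ + X)](_ : _ = \sum_(0 <= i < N.+1 - m) \1_A (iter i S (iter m S w))); last by apply: eq_bigr => i _; rewrite iterD.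
  have := sumle 0%N m (fun i => iter i S w); rewrite subn0 => H1.
  rewrite natrB//.
  have := ler_wpM2l k0 H1.
  have : 0 <= delta * m%:R by exact: mulr_ge0.
  by rewrite !mulrDr mulrN; lra.
have := lb_iter (i := N.+1) (lb0 (iter N.+1 S w)); rewrite add0n; apply: lb_le.
rewrite -(big_mkord xpredT (fun i => \1_A (iter i S w) : R)).
have := sumle 0%N N.+1 (fun i => iter i S w); rewrite subn0 => H1.
have := ler_wpM2l k0 H1.
have : kappa * N.+1%:R <= kappa * K%:R by rewrite ler_wpM2l// ler_nat; lia.
lra.
Qed.

End greedy_covering.

(** * Recurrence and coverings for ergodic shifts *)

Section ergodic_covering.
Context (R : realType) (A : pointedType) (measA : set (set A)).
Variable (P : probability (pathT measA) R).
Hypotheses (stP : stationary P) (ergP : ergodic P).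
Variable (E : nat -> set (pathT measA)).
Hypothesis mE : forall m, measurable (E m).
Hypothesis PE : P (lim_sup_set E) != 0%E.

Let measurable_preshift n (B : set (pathT measA)) : measurable B ->
  measurable (iter n (@shift A) @^-1` B : set (pathT measA)).
Proof. by move=> mB; rewrite -[X in measurable X]setTI; exact: measurable_iter_shift. Qed.

Lemma measurable_lim_sup_set (F : nat -> set (pathT measA)) :
  (forall m, measurable (F m)) -> measurable (lim_sup_set F).
Proof. by move=> mF; apply: bigcapT_measurable => n; apply: bigcup_measurable. Qed.

(** Asking for infinitely many visits makes the set exactly shift-invariant, as [ergodic] requires.
    By stationarity each tail union has at least the probability of [lim_sup_set E], so the
    invariant set is not null. *)
Lemma ergodic_recurrence :
  P (lim_sup_set (fun i => iter i (@shift A) @^-1` lim_sup_set E)) = 1%E.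
Proof.
pose Bad := lim_sup_set E; pose F i : set (pathT measA) := iter i (@shift A) @^-1` Bad.
pose B := lim_sup_set F; change (P B = 1%E).
have mBad : measurable Bad by exact: measurable_lim_sup_set.
have mF i : measurable (F i) by exact: measurable_preshift.
have mB : measurable B by exact: measurable_lim_sup_set.
have BE w : B w <-> forall n, exists2 i, (n <= i)%N & Bad (iter i (@shift A) w).
  by split=> [H n|H n _]; [case: (H n I)|case: (H n)] => i; exists i.
have invB : @shift A @^-1` B = B.
  apply/seteqP; split => w /= /BE H; apply/BE => n.
    by have [i ni Hi] := H n; exists i.+1; [exact: leqW|rewrite iterSr].
  have [[|i] ni Hi] := H n.+1; first by [].
  by exists i => //; rewrite -iterSr.
have PB : (P Bad <= P B)%E.
  have cv : P (\bigcup_(k in [set k | (n <= k)%N]) F k) @[n --> \oo] --> P B.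
    apply: lim_sup_set_cvg => //.
    by rewrite (le_lt_trans (probability_le1 _ _)) ?ltry//; exact: bigcup_measurable.
  apply: cvge_near_ge cv _; apply: nearW => n.
  rewrite -(stationary_iter stP n mBad).
  apply: le_measure; rewrite ?inE//; first exact: measurable_preshift.
    by apply: bigcup_measurable.
  by move=> w Hw; exists n => /=.
case: (ergP mB invB) => // PB0.
by move: PB PE; rewrite PB0 -/Bad measure_le0 => ->.
Qed.

Variables (lb : nat -> pathT measA -> R -> Prop) (delta kappa0 : R) (M0 : nat).
Hypothesis lb_le : forall N w b b', b' <= b -> lb N w b -> lb N w b'.
Hypothesis lb0 : forall w, lb 0%N w 0.
Hypothesis lbS : forall N w b, lb N (@shift A w) b -> lb N.+1 w (b - delta).
Hypothesis lbE : forall m N w b, (M0 <= m)%N -> E m w ->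
  lb N (iter m (@shift A) w) b -> lb (N + m) w (b + kappa0 * m%:R).

(** The sets [E m] themselves may have small probability, but almost every orbit reaches them with
    [m] as large as desired. Lowering the gain from [kappa0] to [kappa] pays for the letters read
    before the block, so almost every point becomes the start of a profitable piece. *)
Lemma ergodic_covering kappa eta : 0 <= kappa < kappa0 -> 0 <= delta -> 0 < eta ->
  exists (C : set (pathT measA)) (K : nat), [/\ measurable C, ((1 - eta)%:E <= P C)%E &
    forall N w, lb N w (kappa * (\sum_(i < N) \1_C (iter i (@shift A) w))
                        - delta * N%:R - kappa * K%:R)].
Proof.
move=> /andP[k0 kk] d0 eta0.
(* A piece consists of [i] letters followed by an exceptional block of length [m]; its net gain is
   at least [kappa] per step, and [K] bounds its total length. *)
pose C K : set (pathT measA) := [set w | exists i m : nat,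
  [/\ (0 < m)%N, (i + m <= K)%N, (M0 <= m)%N,
      kappa * (i + m)%:R <= kappa0 * m%:R - delta * i%:R & E m (iter i (@shift A) w)]].
have mC K : measurable (C K).
  rewrite (_ : C K = \bigcup_i \bigcup_(m in [set m : nat | [/\ (0 < m)%N, (i + m <= K)%N, (M0 <= m)%N &
      kappa * (i + m)%:R <= kappa0 * m%:R - delta * i%:R]]) (iter i (@shift A) @^-1` E m)).
    apply: bigcupT_measurable => i; apply: bigcup_measurable => m _.
    exact: measurable_preshift.
  apply/seteqP; split => w /=.
    by move=> [i [m [? ? ? ? ?]]]; exists i => //; exists m.
  by move=> [i _ [m [? ? ? ?] ?]]; exists i, m.
have ndC : nondecreasing_seq C.
  move=> a b ab; apply/subsetPset => w [i [m [? h ? ? ?]]]; exists i, m; split => //.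
  exact: leq_trans h ab.
have PC : P (\bigcup_K C K) = 1%E.
  apply/eqP; rewrite eq_le probability_le1//=; last exact: bigcupT_measurable.
  rewrite -ergodic_recurrence; apply: le_measure; rewrite ?inE.
  - apply: measurable_lim_sup_set => n; apply: measurable_preshift.
    exact: measurable_lim_sup_set.
  - exact: bigcupT_measurable.
  move=> w /(_ 0%N I) [i _ /= Hi].
  (* A block longer than [q] makes up for the [i] letters before it, since it gains [kappa0 - kappa]
     per step beyond the required rate. *)
  pose q := Num.truncn ((kappa * i%:R + delta * i%:R) / (kappa0 - kappa)).
  have [m /= mge Em] := Hi (maxn M0 q.+1) I.
  exists (i + m)%N => //; exists i, m; split => //.
  - by rewrite (leq_trans _ mge)// leq_max orbT.
  - by rewrite (leq_trans _ mge)// leq_max leqnn.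
  - have qm : (q.+1 <= m)%N by rewrite (leq_trans _ mge)// leq_max leqnn orbT.
    have kk0 : 0 < kappa0 - kappa by rewrite subr_gt0.
    have : (kappa * i%:R + delta * i%:R) / (kappa0 - kappa) <= m%:R.
      by apply: le_trans (ltW (truncnS_gt _)) _; rewrite ler_nat.
    by rewrite ler_pdivrMr// natrD mulrDr; lra.
have cv : P (C K) @[K --> \oo] --> 1%E.
  by rewrite -PC; apply: nondecreasing_cvg_mu => //; exact: bigcupT_measurable.
have [K HK] : exists K, ((1 - eta)%:E < P (C K))%E.
  have : \forall K \near \oo, ((1 - eta)%:E < P (C K))%E.
    by apply: cvge_near_gt cv _; rewrite lte_fin ltrBlDr ltrDl.
  by case=> K _ H; exists K; exact: (H K (leqnn _)).
exists (C K), K; split => //; first exact: ltW.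
apply: (lb_greedy lb_le lb0 lbS k0 d0) => w [i [m [m0 imK M0m kim Em]]].
exists (i + m)%N; split; first by rewrite imK addn_gt0 m0 orbT.
move=> N b; rewrite addnC iterD => /(lbE M0m Em) /(lb_iter lb_le lbS).
rewrite -addnA; apply: lb_le; rewrite natrD; move: kim; rewrite natrD.
by lra.
Qed.

End ergodic_covering.

(** * Ergodic averages: the limsup half of Birkhoff's theorem *)

Section ergodic_sums.
Context (R : realType) (A : pointedType) (measA : set (set A)).
Variable (P : probability (pathT measA) R).
Hypotheses (stP : stationary P).

Lemma integral_shift_sum (g : pathT measA -> R) N : measurable_fun setT g ->
  (forall w, 0 <= g w) ->
  (\int[P]_w (\sum_(i < N) g (iter i (@shift A) w))%:E = N%:R%:E * \int[P]_w (g w)%:E)%E.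
Proof.
move=> mg g0; under eq_integral do rewrite -sumEFin.
rewrite ge0_integral_sum//; last 2 first.
- move=> i; apply/measurable_EFinP.
  exact: (measurableT_comp mg (@measurable_iter_shift _ measA i)).
- by move=> i w _; rewrite lee_fin.
under eq_bigr => i _.
  rewrite (stationary_integral stP i (f := EFin \o g)); [over|exact/measurable_EFinP|].
  by move=> w; rewrite lee_fin.
by rewrite sumr_const card_ord mule_natl.
Qed.

Hypothesis (ergP : ergodic P).

(** The score is the partial sum itself: a letter costs nothing because [f] is nonnegative, and an
    exceptional block has average above [e + eps]. Were such blocks to occur infinitely often with
    positive probability, the covering would push the mean of the partial sums above [N * e]. *)
Lemma birkhoff_limsup (f : pathT measA -> R) (B e : R) : measurable_fun setT f ->
  (forall w, 0 <= f w <= B) -> (\int[P]_w (f w)%:E = e%:E)%E ->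
  forall eps : R, 0 < eps ->
  {ae P, forall w, \forall n \near \oo,
     \sum_(i < n) f (iter i (@shift A) w) <= n%:R * (e + eps)}.
Proof.
move=> mf f0B fe eps eps0.
have f0 w : 0 <= f w by case/andP: (f0B w).
have e0 : 0 <= e by rewrite -lee_fin -fe; apply: integral_ge0 => w _; rewrite lee_fin.
pose Sf n (w : pathT measA) : R := \sum_(i < n) f (iter i (@shift A) w).
have mS n : measurable_fun setT (Sf n).
  apply: measurable_sum => i.
  exact: (measurableT_comp mf (@measurable_iter_shift _ measA i)).
pose E n : set (pathT measA) := [set w | n%:R * (e + eps) < Sf n w].
have mE n : measurable (E n).
  rewrite (_ : E n = Sf n @^-1` `]n%:R * (e + eps), +oo[).
    by rewrite -[X in measurable X]setTI; exact: mS.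
  by apply/seteqP; split => w /=; rewrite in_itv/= andbT.
have P0 : P (lim_sup_set E) = 0%E.
  apply/eqP/negPn/negP => PE.
  pose lb N w b := b <= Sf N w.
  (* With these constants [kappa * (1 - eta)] is still at least [e + eps / 4]; the remaining
     [eps / 4] per step outweighs the boundary loss [kappa * K] once [N] is large. *)
  pose kappa := e + eps / 2; pose eta := eps / (4 * (kappa + 1)).
  have k0 : 0 < kappa by rewrite /kappa; lra.
  have k1 : 0 < kappa + 1 by rewrite addr_gt0.
  have eta0 : 0 < eta by rewrite divr_gt0// mulr_gt0// addr_gt0.
  have keta : kappa * eta <= eps / 4.
    rewrite /eta mulrA ler_pdivrMr; last by rewrite mulr_gt0.
    by have : 0 < eps * kappa := mulr_gt0 eps0 k0; lra.
  have [|||||C [K [mC PC H]]] := @ergodic_covering R A measA P stP ergP E mE PE lb 0 (e + eps) 0 _ _ _ _ kappa eta _ (lexx 0) eta0.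
  - by move=> N w b b' bb' /(le_trans bb').
  - by move=> w; rewrite /lb /Sf big_ord0.
  - move=> N w b; rewrite /lb /Sf subr0 big_ord_recl /= => h.
    rewrite (eq_bigr (fun i : 'I_N => f (iter i (@shift A) (shift w)))); last first.
      by move=> i _; rewrite add0n -iterSr.
    by rewrite (le_trans h)// lerDr.
  - move=> m N w b _; rewrite /lb /Sf /E /= => Em h.
    rewrite addnC big_split_ord/= addrC lerD//.
      apply: (le_trans h); apply: ler_sum => i _.
      by rewrite addnC iterD.
    by rewrite mulrC; exact: ltW.
  - by apply/andP; split; [exact: ltW|rewrite /kappa; lra].
  have PCf : P C \is a fin_num by rewrite fin_num_measure.
  have Hint N : kappa * (N%:R * fine (P C)) <= N%:R * e + kappa * K%:R.
    rewrite -lee_fin.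
    have -> : ((kappa * (N%:R * fine (P C)))%:E =
        \int[P]_w (\sum_(i < N) (kappa * \1_C (iter i (@shift A) w)))%:E)%E.
      rewrite (integral_shift_sum (g := fun w => kappa * \1_C w)) //; last first.
      - by move=> w; rewrite mulr_ge0// ltW.
      - by apply: measurable_funM => //.
      under eq_integral do rewrite EFinM.
      rewrite ge0_integralZl_EFin//; [|exact/measurable_EFinP|exact: ltW].
      by rewrite integral_indic// setIT !EFinM fineK// muleCA.
    have -> : ((N%:R * e + kappa * K%:R)%:E = \int[P]_w ((Sf N w)%:E + (kappa * K%:R)%:E))%E.
      rewrite ge0_integralD//.
      - by rewrite integral_shift_sum// fe integral_cst//= probability_setT mule1.
      - by move=> w _; rewrite lee_fin sumr_ge0.
      - exact/measurable_EFinP.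
      - by move=> w _; rewrite lee_fin mulr_ge0// ltW.
    apply: ge0_le_integral => //.
    - by move=> w _; rewrite lee_fin sumr_ge0// => i _; rewrite mulr_ge0// ltW.
    - apply/measurable_EFinP; apply: measurable_sum => i; apply: measurable_funM => //.
      by apply: (@measurableT_comp _ _ _ _ _ _ (\1_C : _ -> R)) => //; exact: measurable_iter_shift.
    - by apply: emeasurable_funD => //; exact/measurable_EFinP.
    move=> w _; rewrite -EFinD lee_fin -mulr_sumr.
    by have := H N w; rewrite /lb mul0r subr0; lra.
  have {}PC : 1 - eta <= fine (P C) by rewrite -lee_fin fineK.
  have kP : kappa * (1 - eta) <= kappa * fine (P C) by rewrite ler_pM2l.
  pose N := (Num.truncn (kappa * K%:R / (eps / 4))).+1.
  have N1 : kappa * K%:R < N%:R * (eps / 4).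
    by rewrite -ltr_pdivrMr ?divr_gt0// truncnS_gt.
  have := Hint N; rewrite mulrCA => HN.
  have : N%:R * (e + eps / 4) <= N%:R * (kappa * fine (P C)).
    by rewrite ler_wpM2l//; apply: le_trans kP; rewrite mulrDr mulr1 mulrN {1}/kappa; lra.
  by rewrite mulrDr; lra.
exists (lim_sup_set E); split => //; first exact: measurable_lim_sup_set.
move=> w /= nE n _; apply: contrapT => H; apply: nE.
exists n => // m nm /=; rewrite leNgt; apply/negP => Em; apply: H.
by exists m.
Qed.

End ergodic_sums.

(** * Renewal mixtures and the lower bound *)

Section seq_functions.
Context (R : realType) d (T : measurableType d) (mu : {finite_measure set T -> \bar R}).
Local Open Scope ereal_scope.

Lemma integral_mupowS n (f : n.+1.-tuple T -> \bar R) :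
  (forall t, 0 <= f t) -> measurable_fun setT f ->
  \int[mupow mu n.+1]_t f t = \int[mu]_x \int[mupow mu n]_t f (cons_tuple x t).
Proof.
move=> f0 mf; rewrite -iintE//=; apply: eq_integral => x _; rewrite iintE//.
by have := measurableT_comp (measurableT_comp mf (@measurable_tcons _ T n)) (pair1_measurable x).
Qed.

Lemma integral_mupow0 (f : 0.-tuple T -> \bar R) : (forall t, 0 <= f t) -> measurable_fun setT f ->
  \int[mupow mu 0]_t f t = f [tuple].
Proof. by move=> f0 mf; rewrite -iintE. Qed.

(** Subdensities of all lengths are combined into one function on sequences, so that prefixes and
    suffixes can be taken without casts between tuple types. *)
Definition seq_measurable (F : seq T -> \bar R) :=
  forall n, measurable_fun setT (fun t : n.-tuple T => F t).

Lemma seq_measurable_cons F x : seq_measurable F -> seq_measurable (fun s => F (x :: s)).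
Proof.
move=> mF n.
by have := measurableT_comp (measurableT_comp (mF n.+1) (@measurable_tcons _ T n)) (pair1_measurable x).
Qed.

Lemma measurable_take n m : measurable_fun setT (fun t : n.-tuple T => take_tuple m t).
Proof.
apply/measurable_fun_tnthP => i.
have iN : (i < n)%N by rewrite (leq_trans (ltn_ord i))// geq_minr.
rewrite (_ : _ \o _ = (fun t => tnth t (Ordinal iN))); first exact: measurable_tnth.
apply/funext => t /=; rewrite (tnth_nth (tnth t (Ordinal iN))) /= nth_take; last first.
  by rewrite (leq_trans (ltn_ord i))// geq_minl.
by rewrite [RHS](tnth_nth (tnth t (Ordinal iN))).
Qed.

Lemma measurable_drop n m : measurable_fun setT (fun t : n.-tuple T => drop_tuple m t).
Proof.
apply/measurable_fun_tnthP => i.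
have iN : (m + i < n)%N by have := ltn_ord i; lia.
rewrite (_ : _ \o _ = (fun t => tnth t (Ordinal iN))); first exact: measurable_tnth.
apply/funext => t /=; rewrite (tnth_nth (tnth t (Ordinal iN))) /= nth_drop.
by rewrite [RHS](tnth_nth (tnth t (Ordinal iN))).
Qed.

Lemma seq_measurable_take F m : seq_measurable F -> seq_measurable (fun s => F (take m s)).
Proof. by move=> mF n; exact: (measurableT_comp (mF _) (@measurable_take n m)). Qed.

Lemma seq_measurable_drop F m : seq_measurable F -> seq_measurable (fun s => F (drop m s)).
Proof. by move=> mF n; exact: (measurableT_comp (mF _) (@measurable_drop n m)). Qed.

Lemma integral_mupow_cat F G m n : seq_measurable F -> seq_measurable G ->
  (forall s, 0 <= F s) -> (forall s, 0 <= G s) ->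
  \int[mupow mu (m + n)]_t (F (take m t) * G (drop m t)) =
  \int[mupow mu m]_t F t * \int[mupow mu n]_t G t.
Proof.
move=> mF mG F0 G0; elim: m F mF F0 => [|m IH] F mF F0.
  rewrite integral_mupow0//; under eq_integral do rewrite take0 drop0.
  by rewrite ge0_integralZl//; exact: mG.
have mFG : measurable_fun setT (fun t : (m + n).+1.-tuple T => F (take m.+1 t) * G (drop m.+1 t)).
  by apply: emeasurable_funM; [exact: (seq_measurable_take m.+1 mF)|exact: (seq_measurable_drop m.+1 mG)].
transitivity (\int[mu]_x (\int[mupow mu (m + n)]_t (F (x :: take m t) * G (drop m t)))).
  by apply: (@integral_mupowS (m + n) _ _ mFG) => t; exact: mule_ge0.
under eq_integral => x _ do rewrite (IH (fun s => F (x :: s)) (seq_measurable_cons x mF) (fun s => F0 _)).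
rewrite integral_mupowS ?ge0_integralZr//.
- have := @measurable_fun_fubini_tonelli_F _ _ _ _ _ (mupow mu m) (fun z : T * m.-tuple T => F (tcons z)).
  apply=> //; exact: (measurableT_comp (mF m.+1) (@measurable_tcons _ T m)).
- by move=> x _; apply: integral_ge0.
- by apply: integral_ge0.
Qed.

Lemma integral_mupow_behead (F : seq T -> \bar R) n : seq_measurable F -> (forall s, 0 <= F s) ->
  \int[mupow mu n.+1]_t F (behead t) = mu setT * \int[mupow mu n]_t F t.
Proof.
move=> mF F0; rewrite integral_mupowS//; last first.
  have := seq_measurable_drop 1 mF (n := n.+1); congr measurable_fun.
  by apply/funext => t; rewrite drop1.
by under eq_integral do rewrite /=; rewrite integral_cst// muleC.
Qed.

End seq_functions.

Section renewal.
Context (R : realType) d (T : measurableType d) (mu : {finite_measure set T -> \bar R}).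
Variables (q : seq T -> \bar R) (a : R) (b : nat -> R).
Local Open Scope ereal_scope.

(* Sum over the parsings of [s] into single letters, of weight [a], and blocks of length m+1,
   of weight [b m * q]; the meaningful case is [size s <= fuel]. *)
Fixpoint renewal (fuel : nat) (s : seq T) : \bar R :=
  if fuel is N.+1 then
    if s is _ :: _ then a%:E * renewal N (behead s) +
       \sum_(m < size s) (b m)%:E * (q (take m.+1 s) * renewal N (drop m.+1 s))
    else 1
  else 1.

Hypotheses (a0 : (0 <= a)%R) (b0 : forall m, (0 <= b m)%R) (q0 : forall s, 0 <= q s).
Hypothesis mq : seq_measurable q.
Hypothesis q1 : forall m, \int[mupow mu m]_t q t <= 1.
Hypothesis ab1 : forall N, a%:E * mu setT + (\sum_(m < N) b m)%:E <= 1.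

Lemma renewal_ge0 N s : 0 <= renewal N s.
Proof.
elim: N s => [|N IH] [|x s]; rewrite /= ?lee01//.
rewrite adde_ge0 ?mule_ge0 ?lee_fin//; apply: sume_ge0 => m _.
by rewrite mule_ge0 ?lee_fin// mule_ge0.
Qed.

(** After a block the recursion has more fuel than letters left; this identifies the result with the
    mixture at fuel equal to the length, the form in which scores are measured. *)
Lemma renewal_fuel N N' s : (size s <= N)%N -> (size s <= N')%N -> renewal N s = renewal N' s.
Proof.
elim: N N' s => [|N IH] [|N'] [|x s] //= sN sN'.
rewrite (IH N')//; congr (_ + _); apply: eq_bigr => m _; congr (_ * (_ * _)).
by apply: IH; rewrite size_drop; rewrite ltnS in sN sN'; lia.
Qed.

Lemma measurable_renewal N : seq_measurable (renewal N).
Proof.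
elim: N => [|N IH] [|n] /=; [exact: measurable_cst|exact: measurable_cst| |].
  rewrite (_ : (fun _ => _) = cst 1); first exact: measurable_cst.
  by apply/funext => t; rewrite (tuple0 t).
rewrite (_ : (fun _ => _) = fun t : n.+1.-tuple T => a%:E * renewal N (drop 1 t) +
   \sum_(m < n.+1) (b m)%:E * (q (take m.+1 t) * renewal N (drop m.+1 t))); last first.
  apply/funext => t; case: t => [[//|x s] st] /=; rewrite drop0.
  by move: st => /eqP [st]; rewrite /= st.
apply: emeasurable_funD.
  by apply: emeasurable_funM => //; exact: (seq_measurable_drop 1 IH).
apply: emeasurable_sum => m; apply: emeasurable_funM => //; apply: emeasurable_funM.
  exact: (seq_measurable_take m.+1 mq).
exact: (seq_measurable_drop m.+1 IH).
Qed.

(** Split according to the first piece of the parsing: a letter contributes at most [a * mu setT], a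
    block of length [m + 1] at most [b m], because by induction the mixture on the rest has mass at
    most 1. *)
Lemma integral_renewal_le1 N n : (n <= N)%N -> \int[mupow mu n]_t renewal N t <= 1.
Proof.
elim: N n => [|N IH] [|n] // nN.
- by rewrite integral_mupow0//=.
- rewrite integral_mupow0//; first by move=> t; exact: renewal_ge0.
  exact: measurable_renewal.
rewrite (eq_integral (fun t : n.+1.-tuple T => a%:E * renewal N (drop 1 t) +
   \sum_(m < n.+1) (b m)%:E * (q (take m.+1 t) * renewal N (drop m.+1 t)))); last first.
  move=> t _; case: t => [[//|x s] st] /=; rewrite drop0.
  by move: st => /eqP [st]; rewrite /= st.
have m1 : measurable_fun setT (fun t : n.+1.-tuple T => renewal N (drop 1 t)).
  exact: (seq_measurable_drop 1 (@measurable_renewal N)).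
have m2 m : measurable_fun setT (fun t : n.+1.-tuple T => q (take m.+1 t) * renewal N (drop m.+1 t)).
  by apply: emeasurable_funM; [exact: (seq_measurable_take m.+1 mq)|
    exact: (seq_measurable_drop m.+1 (@measurable_renewal N))].
have p2 m (t : n.+1.-tuple T) : 0 <= q (take m.+1 t) * renewal N (drop m.+1 t).
  by rewrite mule_ge0// renewal_ge0.
rewrite ge0_integralD//; last 4 first.
- by move=> t _; rewrite mule_ge0 ?renewal_ge0 ?lee_fin.
- exact: emeasurable_funM.
- by move=> t _; apply: sume_ge0 => m _; rewrite mule_ge0 ?lee_fin.
- by apply: emeasurable_sum => m; exact: emeasurable_funM.
rewrite ge0_integralZl//; last by move=> t _; exact: renewal_ge0.
under eq_integral do rewrite drop1.
rewrite integral_mupow_behead; [|exact: measurable_renewal|exact: renewal_ge0].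
rewrite ge0_integral_sum//; last 2 first.
- by move=> m; exact: emeasurable_funM.
- by move=> m t _; rewrite mule_ge0 ?lee_fin.
apply: le_trans (ab1 n.+1); apply: leeD.
  rewrite lee_wpmul2l ?lee_fin//; apply: (@le_trans _ _ (mu setT * 1)); last by rewrite mule1.
  by rewrite lee_wpmul2l// IH.
rewrite -sumEFin; apply: lee_sum => m _.
rewrite (ge0_integralZl _ measurableT (m2 m)) ?lee_fin//.
rewrite -[leRHS]mule1 lee_wpmul2l ?lee_fin//.
have mn : (m.+1 + (n - m) = n.+1)%N by have := ltn_ord m; lia.
rewrite (_ : integral _ _ _ = \int[mupow mu (m.+1 + (n - m))]_t
  (q (take m.+1 t) * renewal N (drop m.+1 t))); last by rewrite mn.
rewrite integral_mupow_cat//; [|exact: measurable_renewal|exact: renewal_ge0].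
rewrite -[leRHS]mule1; apply: lee_pmul => //.
- by apply: integral_ge0.
- by apply: integral_ge0 => t _; exact: renewal_ge0.
- by apply: IH; have := ltn_ord m; lia.
Qed.

Lemma renewal_single N x s : (size s <= N)%N ->
  a%:E * renewal N s <= renewal N.+1 (x :: s).
Proof.
move=> sN /=; rewrite leeDl//; apply: sume_ge0 => m _.
by rewrite mule_ge0 ?lee_fin// mule_ge0// renewal_ge0.
Qed.

Lemma renewal_block N M s : (0 < M)%N -> size s = (N + M)%N ->
  (b M.-1)%:E * (q (take M s) * renewal N (drop M s)) <= renewal (N + M) s.
Proof.
case: M => // M _ /= sM; rewrite addnS in sM *.
case: s sM => // x s sM /=; have sM' : (M < size (x :: s))%N by rewrite sM; lia.
apply: (@le_trans _ _ (\sum_(m < size (x :: s)) (b m)%:E *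
    (q (take m.+1 (x :: s)) * renewal (N + M) (drop m.+1 (x :: s))))); last first.
  by rewrite leeDr// mule_ge0 ?lee_fin// renewal_ge0.
rewrite (bigD1 (Ordinal sM'))//=.
rewrite (@renewal_fuel N (N + M) (drop M s)) ?leeDl//.
- apply: sume_ge0 => m _.
  by rewrite mule_ge0 ?lee_fin// mule_ge0// renewal_ge0.
- by move: sM => /= [sM]; rewrite size_drop sM; lia.
- by move: sM => /= [sM]; rewrite size_drop sM; lia.
Qed.

End renewal.

(** The integral is the difference of those of the positive and negative parts, and such a
    difference is finite only if both are. *)
Lemma fin_num_integrable d (T : measurableType d) (R : realType) (m : {measure set T -> \bar R})
    (f : T -> \bar R) : measurable_fun setT f -> (\int[m]_t f t)%E \is a fin_num ->
  m.-integrable setT f.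
Proof.
move=> mf; rewrite integralE fin_numB => /andP[f1 f2].
apply/integrableP; split => //.
under eq_integral => x _ do rewrite (_ : `|f x|%E = (f^\+ x + f^\- x)%E) ?[LHS](congr1 (@^~ x) (fune_abse f))//.
rewrite ge0_integralD//; [|exact: measurable_funepos|exact: measurable_funeneg].
by rewrite lte_add_pinfty// ltey_eq ?f1 ?f2.
Qed.

(** * Integrability and a first bound on the entropy rate *)

Section entropy_bounds.
Context (R : realType) d (T : measurableType d) (mu : {finite_measure set T -> \bar R}).
Context (P : probability (Xpath T) R) (p : forall n, n.-tuple T -> \bar R) (h : R).
Hypothesis EP : in_E_mu mu P p h.
Local Open Scope ereal_scope.

Lemma E_mu_density n : is_density mu P (@p n). Proof. by case: EP. Qed.

Lemma measurable_neglog_density n :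
  measurable_fun setT (fun w : Xpath T => neglog (@p n (X1n n w))).
Proof.
apply: (measurable_fun_X1n (g := fun t => neglog (@p n t))).
by apply: measurableT_comp (@measurable_neglog R) _; case: (E_mu_density n).
Qed.

(** The statement is only eventual: convergence of the normalized means to a real number leaves
    finitely many [n] free. *)
Lemma E_mu_integrable :
  \forall n \near \oo, P.-integrable setT (fun w => neglog (@p n (X1n n w))).
Proof.
case: EP => _ _ _ /fine_cvgP[fin _]; near=> n.
apply: fin_num_integrable; first exact: measurable_neglog_density.
have n0 : (0 < n%:R^-1 :> R)%R by rewrite invr_gt0 ltr0n; near: n; exact: nbhs_infty_gt.
have : n%:R^-1%:E * \int[P]_w neglog (@p n (X1n n w)) \is a fin_num by near: n.
case: (\int[P]_w _) => //.
  by rewrite gt0_muley.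
by rewrite gt0_muleNy.
Unshelve. all: by end_near. Qed.

Lemma mupow_setT n : mupow mu n setT = (fine (mu setT) ^+ n)%:E.
Proof.
elim: n => [|n IH]; first by rewrite /= diracT.
have := @integral_mupowS R d T mu n (fun=> 1) (fun _ => @lee01 R) (measurable_cst _).
rewrite integral_cst// mul1e => ->.
rewrite (eq_integral (fun=> (fine (mu setT) ^+ n)%:E)) => [|x _].
  by rewrite integral_cst// exprSr EFinM fineK ?fin_num_measure.
by rewrite integral_cst// mul1e; exact: IH.
Qed.

(** A null measure cannot carry the density [p 1], whose integral is 1. *)
Lemma E_mu_mass_gt0 : (0 < fine (mu setT))%R.
Proof.
rewrite lt_neqAle fine_ge0// andbT eq_sym; apply/eqP => M0.
have := integral_density_eq1 (E_mu_density 1).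
have p0 t : 0 <= @p 1 t by case: (E_mu_density 1).
have mp : measurable_fun setT (@p 1) by case: (E_mu_density 1).
have muT : mu setT = 0 by rewrite -(fineK (fin_num_measure mu setT measurableT)) M0.
rewrite integral_mupowS// (eq_integral (fun x => @p 1%N (cons_tuple x [tuple]))); last first.
  move=> x _; rewrite integral_mupow0//.
  exact: (measurableT_comp (measurableT_comp mp (@measurable_tcons _ T 0)) (pair1_measurable x)).
rewrite (@ge0_negligible_integral _ _ _ mu setT setT)// ?setDv ?integral_set0.
- by move=> /eqP; rewrite eq_sym eqe oner_eq0.
- have := measurableT_comp mp (@measurable_cons _ _ T T id 0 (fun=> [tuple]) (@measurable_id _ T setT) (measurable_cst _)).
  by congr measurable_fun; apply/funext => x; congr (p _); exact/val_inj.
Qed.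

(** Gibbs' inequality against the uniform density on [n]-tuples. In the lower bound it ensures that
    an exceptional block gains over letters coded at the uniform rate. *)
Lemma E_mu_rate_le_ln : (h <= ln (fine (mu setT)))%R.
Proof.
have M0 := E_mu_mass_gt0; set M := fine (mu setT) in M0 *.
case: (EP) => _ _ _ cv; rewrite -lee_fin.
apply: cvge_near_le cv _; near=> n.
have n0 : (0 < n%:R :> R)%R by rewrite ltr0n; near: n; exact: nbhs_infty_gt.
rewrite lee_pdivrMl//.
have ip : P.-integrable setT (fun w => neglog (@p n (X1n n w))).
  by near: n; exact: E_mu_integrable.
have Mn0 : (0 < M ^+ n)%R by exact: exprn_gt0.
have -> : (n%:R%:E * (ln M)%:E = \int[P]_w neglog ((M ^+ n)^-1%:E : \bar R)).
  rewrite /neglog gt_eqF ?invr_gt0//.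
  by rewrite integral_cst//= probability_setT mule1 lnV ?posrE// opprK lnXn// -EFinM mulr_natl.
apply: (@integral_neglog_le _ _ _ _ _ _ _ (E_mu_density n) (cst (M ^+ n)^-1%:E)) => //.
- by move=> t; rewrite lee_fin ltW// invr_gt0.
- by rewrite integral_cst// [X in _ * X](@mupow_setT n) -EFinM mulVf// gt_eqF.
Unshelve. all: by end_near. Qed.

End entropy_bounds.

Lemma sum_recip_consecutive (R : realType) N :
  \sum_(m < N) ((m.+1%:R * m.+2%:R)^-1 : R) = 1 - N.+1%:R^-1.
Proof.
elim: N => [|N IH]; first by rewrite big_ord0 invr1 subrr.
rewrite big_ord_recr/= IH .
have e1 : N.+1%:R = N%:R + 1 :> R by rewrite natr1.
have e2 : N.+2%:R = N%:R + 1 + 1 :> R by rewrite !natr1.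
rewrite e1 e2; have N0 : 0 <= N%:R :> R by [].
by field; apply/andP; split; lra.
Qed.

(** The weight of a block is the reciprocal of a quadratic in its length; this shows that for long
    blocks it costs at most [delta] per letter. *)
Lemma quadratic_le_expR (R : realType) (delta c : R) : 0 < delta -> 0 < c ->
  exists M0 : nat, forall m : nat, (M0 <= m)%N -> (m.+1%:R * m.+2%:R) <= c * expR (delta * m.+1%:R).
Proof.
(* With [x = m + 1], use [x (x + 1) <= 2 x^2] and [x^3 delta^3 / 6 <= exp(delta x)]; the threshold
   12 is [2 * 6]. *)
move=> d0 c0; exists (Num.truncn (12 / (c * delta ^+ 3))).+1 => m Hm.
have cd0 : 0 < c * delta ^+ 3 by rewrite mulr_gt0// exprn_gt0.
have H1 : 12 <= c * delta ^+ 3 * m.+1%:R.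
  rewrite mulrC -ler_pdivrMr//; apply: (le_trans (ltW (truncnS_gt _))).
  by rewrite ler_nat ltnS; exact: ltnW.
have H2 := @expR_ge1Dxn R (delta * m.+1%:R) 2 (mulr_ge0 (ltW d0) (ler0n _ _)).
have H3 : c * ((delta * m.+1%:R) ^+ 3 / 6) <= c * expR (delta * m.+1%:R).
  rewrite ler_pM2l//; apply: le_trans H2.
  by rewrite (_ : 3`!%:R = 6)// lerDr.
apply: le_trans H3.
have m1 : 1 <= m.+1%:R :> R by rewrite ler1n.
rewrite (_ : m.+2%:R = m.+1%:R + 1) ?natr1//; set x : R := m.+1%:R in H1 m1 *.
rewrite (_ : c * _ = (c * delta ^+ 3 * x) * (x ^+ 2) / 6); last by ring.
have : 12 * x ^+ 2 <= (c * delta ^+ 3 * x) * x ^+ 2 by rewrite ler_wpM2r// sqr_ge0.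
by nra.
Qed.

(** * The almost sure lower bound *)

Section lower_bound.
Context (R : realType) d (T : measurableType d) (mu : {finite_measure set T -> \bar R}).
Context (P : probability (Xpath T) R) (p : forall n, n.-tuple T -> \bar R) (h : R).
Hypothesis EP : in_E_mu mu P p h.
Variable (q : seq T -> \bar R).
Hypotheses (q0 : forall s, (0 <= q s)%E) (mq : seq_measurable q).
Hypothesis q1 : forall m, (\int[mupow mu m]_t q t <= 1)%E.

Let S := @shift T.

Lemma neglog_le_lower (y : \bar R) (c : R) : ((expR c)%:E <= y)%E -> (neglog y <= (- c)%:E)%E.
Proof.
case: y => [r| |]//=; last by rewrite leNye.
rewrite lee_fin => cr; have r0 : 0 < r := lt_le_trans (expR_gt0 c) cr.
by rewrite gt_eqF// lee_fin lerN2 -[c]expRK ler_ln// posrE expR_gt0.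
Qed.

Definition exceedance (c : R) (m : nat) : set (Xpath T) :=
  [set w | ((expR (- (m%:R * c)))%:E <= q (X1n m w))%E].

Lemma measurable_exceedance c m : measurable (exceedance c m).
Proof.
rewrite (_ : exceedance c m = (fun w : Xpath T => q (X1n m w)) @^-1` `[(expR (- (m%:R * c)))%:E, +oo[).
  rewrite -[X in measurable X]setTI.
  apply: (measurable_fun_X1n (@mq m)) => //; exact: emeasurable_itv.
by apply/seteqP; split => w /=; rewrite /exceedance/= in_itv/= ?andbT.
Qed.

(** If exceedances recurred, the mixture would code the process at mean rate at most
    [c + 17 / 6 * delta], which is below [c + 3 * delta = h] and contradicts Gibbs' inequality. *)
Lemma io_exceedance_null (c : R) : c < h -> P (lim_sup_set (exceedance c)) = 0%E.
Proof.
move=> ch; pose E := exceedance c; apply/eqP/negPn/negP => PE.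
have mE m : measurable (E m) by exact: measurable_exceedance.
have M0 := E_mu_mass_gt0 EP; set M := fine (mu setT) in M0.
have hM : h <= ln M := E_mu_rate_le_ln EP.
pose delta := (h - c) / 3; have d0 : 0 < delta by rewrite divr_gt0// subr_gt0.
have hE : h = c + 3 * delta by rewrite /delta; lra.
clearbody delta; pose d1 := 1 - expR (- delta).
have d1E : d1 = 1 - expR (- delta) by [].
have d10 : 0 < d1 by rewrite subr_gt0 expR_lt1// oppr_lt0.
clearbody d1.
have [M0' HM0] := quadratic_le_expR d0 d10.
(* The letters use mass [exp(- delta)] and leave [d1] for the blocks, whose weights telescope to
   less than [d1]. *)
pose a := expR (- delta) / M.
pose b m := d1 / (m.+1%:R * m.+2%:R) : R.
pose r := renewal q a b.
have a0 : 0 <= a by rewrite divr_ge0// ?expR_ge0// ltW.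
have b0 m : 0 < b m by rewrite divr_gt0// mulr_gt0.
have b0' m : 0 <= b m by exact: ltW.
have ab1 N : (a%:E * mu setT + (\sum_(m < N) b m)%:E <= 1)%E.
  rewrite -(fineK (fin_num_measure mu setT measurableT)) -EFinM -EFinD lee_fin.
  rewrite -mulr_sumr sum_recip_consecutive -/M /a divfK ?gt_eqF//.
  have : 0 < N.+1%:R^-1 :> R by rewrite invr_gt0.
  by move: (N.+1%:R^-1) => x x0; have H := mulr_gt0 d10 x0; rewrite mulrBr mulr1; lra.
pose lb N (w : Xpath T) (b : R) := ((expR (b - N%:R * ln M))%:E <= r N (X1n N w))%E.
(* Relative to the rate [- ln M] of the uniform density, a letter loses [delta] and an
   exceedance block of length [m] gains at least [kappa0 * m]. *)
pose kappa0 := ln M - c - delta.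
have k0 : 2 * delta <= kappa0 by rewrite /kappa0; lra.
(* Passing from [kappa0] to [kappa] and then to [kappa * (1 - eta)] loses at most [delta / 3] each
   time. *)
pose kappa := kappa0 - delta / 3; pose eta := delta / (3 * (kappa + 1)).
have kg : 0 < kappa by rewrite /kappa; lra.
have k1 : 0 < kappa + 1 by rewrite addr_gt0.
have eta0 : 0 < eta by rewrite divr_gt0// mulr_gt0.
have keta : kappa * eta <= delta / 3.
  rewrite /eta mulrA ler_pdivrMr; last by rewrite mulr_gt0.
  by have := mulr_gt0 d0 kg; lra.
have r0 N s : (0 <= r N s)%E by exact: renewal_ge0.
have kk : 0 <= kappa < kappa0 by apply/andP; split; [exact: ltW|rewrite /kappa; lra].
have stP : stationary P by case: EP.
have ergP : ergodic P by case: EP.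
have [||||C [K [mC PC H]]] := @ergodic_covering R T _ P stP ergP E mE PE lb delta kappa0 M0'.+1
    _ _ _ _ kappa eta kk (ltW d0) eta0.
- move=> N w x y yx; apply: le_trans; rewrite lee_fin ler_expR; lra.
- by move=> w; rewrite /lb mul0r subr0 expR0 /r /=.
- move=> N w x; rewrite /lb => Hx.
  have := X1n_cat 1 N w; rewrite addn1 => ->.
  have -> : X1n 1 w = [:: w 1] :> seq T by rewrite /X1n/= enum_ordSl enum_ord0.
  apply: le_trans (renewal_single a0 b0' q0 _ _); last by rewrite size_tuple.
  apply: (@le_trans _ _ (a%:E * (expR (x - N%:R * ln M))%:E)%E); last first.
    by rewrite lee_wpmul2l// lee_fin.
  rewrite -EFinM lee_fin /a -{2}(lnK M0)// -expRN -!expRD ler_expR.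
  by rewrite -natr1 mulrDl mul1r; lra.
- move=> [|m] N w x // Mm; rewrite /E /exceedance /lb /= => Em Hx.
  have sX : size (X1n (N + m.+1) w) = (N + m.+1)%N by rewrite size_tuple.
  apply: le_trans (renewal_block a0 b0' q0 _ sX); last by [].
  have -> : take m.+1 (X1n (N + m.+1) w) = X1n m.+1 w.
    by rewrite X1n_cat take_size_cat ?size_tuple.
  have -> : drop m.+1 (X1n (N + m.+1) w) = X1n N (iter m.+1 S w).
    by rewrite X1n_cat drop_size_cat ?size_tuple.
  apply: (@le_trans _ _ ((b m)%:E * ((expR (- (m.+1%:R * c)))%:E * (expR (x - N%:R * ln M))%:E))%E); last first.
    rewrite lee_wpmul2l ?lee_fin//; apply: lee_pmul => //; rewrite lee_fin expR_ge0//.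
  rewrite -!EFinM lee_fin.
  have bm : expR (- (delta * m.+1%:R)) <= b m.
    rewrite expRN -[leLHS]mul1r ler_pdivrMr ?expR_gt0// /b mulrAC ler_pdivlMr ?mulr_gt0// mul1r.
    exact: HM0.
  apply: le_trans (ler_wpM2r _ bm); last by rewrite mulr_ge0 ?expR_ge0.
  rewrite -!expRD ler_expR /kappa0 natrD mulrDl; lra.
have PCf : P C \is a fin_num by rewrite fin_num_measure.
have {}PC : 1 - eta <= fine (P C) by rewrite -lee_fin fineK.
have kP : kappa * (1 - eta) <= kappa * fine (P C) by rewrite ler_pM2l.
(* The constant is [1 + 5 / 3 + 1 / 6]: the discount of the letters, the gap between
   [kappa * (1 - eta)] and [ln M - c], and the boundary term [kappa * K <= N * delta / 6]. The terms
   [ln M] cancel. *)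
have key : \forall N \near \oo, ((N%:R)^-1%:E * \int[P]_w neglog (p (X1n N w)) <=
    (c + 17 / 6 * delta)%:E)%E.
  near=> N.
  have N0 : 0 < N%:R :> R by rewrite ltr0n; near: N; exact: nbhs_infty_gt.
  have KN : kappa * K%:R / (delta / 6) <= N%:R by near: N; exact: nbhs_infty_ger.
  move: KN; rewrite ler_pdivrMr ?divr_gt0// => KN.
  have ip : P.-integrable setT (fun w => neglog (p (X1n N w))).
    by near: N; exact: E_mu_integrable EP.
  rewrite lee_pdivrMl//.
  apply: le_trans (integral_neglog_le (E_mu_density EP N) (r := fun t => r N t) _ _ _ ip) _.
  - by move=> t; exact: r0.
  - exact: measurable_renewal.
  - exact: integral_renewal_le1.
  pose g (w : Xpath T) : R := \sum_(i < N) \1_C (iter i (@shift T) w).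
  pose L : R := delta * N%:R + kappa * K%:R + N%:R * ln M.
  have mg : measurable_fun setT g.
    apply: measurable_sum => i.
    by apply: (@measurableT_comp _ _ _ _ _ _ (\1_C : _ -> R)) => //; exact: measurable_iter_shift.
  have g0 w : 0 <= g w by apply: sumr_ge0.
  have intg : (\int[P]_w (g w)%:E = (N%:R * fine (P C))%:E)%E.
    rewrite (integral_shift_sum stP)//.
    by rewrite integral_indic// setIT EFinM fineK.
  have ig : P.-integrable setT (EFin \o g).
    apply: fin_num_integrable; first exact/measurable_EFinP.
    by rewrite [X in X \is a fin_num]intg.
  apply: (@le_trans _ _ (\int[P]_w (L%:E - kappa%:E * (g w)%:E))%E).
    apply: le_integral_ae.
    - apply: (measurable_fun_X1n (g := fun t => neglog (r N t))).
      by apply: measurableT_comp (@measurable_neglog R) _; exact: measurable_renewal.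
    - apply: emeasurable_funB => //; apply: emeasurable_funM => //; exact/measurable_EFinP.
    apply: aeW => w; apply: le_trans (neglog_le_lower (H N w)) _.
    by rewrite -EFinM -EFinB lee_fin /L /g; lra.
  have iL : P.-integrable setT (fun=> L%:E) by exact: finite_measure_integrable_cst.
  rewrite integralB//; last by exact: integrableZl.
  rewrite integral_cst//= probability_setT mule1 integralZl// intg -!EFinM -EFinB lee_fin.
  rewrite mulrDr /L.
  have : N%:R * (kappa * (1 - eta)) <= N%:R * (kappa * fine (P C)) by rewrite ler_wpM2l.
  have : N%:R * (kappa * (1 - eta)) >= N%:R * (ln M - c - 5 / 3 * delta).
    rewrite ler_wpM2l//; rewrite mulrBr mulr1 {1}/kappa /kappa0; lra.
  by rewrite mulrCA !mulrDr !mulrN; lra.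
case: (EP) => _ _ _ cv; have : (h%:E <= (c + 17 / 6 * delta)%:E)%E by exact: cvge_near_le cv key.
by rewrite lee_fin hE; lra.
Unshelve. all: by end_near. Qed.

End lower_bound.

(** * Entropy of the quantized process *)

Section fekete.
Context (R : realType) (u : nat -> R).
Hypotheses (u0 : forall n, 0 <= u n) (usub : forall m n, u (m + n) <= u m + u n).

(** Fekete's lemma. The second conjunct is what later allows a single block length to bound the
    entropy rate from above. The proof carries [u 0] along, since subadditivity does not make it
    vanish. *)
Lemma subadditive_cvg : exists H : R,
  (n%:R^-1 * u n @[n --> \oo] --> H) /\ forall n, (0 < n)%N -> H <= n%:R^-1 * u n.
Proof.
pose A := [set n%:R^-1 * u n | n in [set n | (0 < n)%N]].
have A0 x : A x -> 0 <= x by move=> [n _ <-]; rewrite mulr_ge0// invr_ge0.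
have hA : has_inf A by split; [exists (1^-1 * u 1%N), 1%N|exists 0 => x /A0].
have Hle n : (0 < n)%N -> inf A <= n%:R^-1 * u n.
  by move=> n0; apply: ge_inf; [case: hA|exists n].
exists (inf A); split => //.
have umul q k : u (q * k)%N <= q%:R * u k + u 0%N.
  elim: q => [|q IH]; first by rewrite mul0n mul0r add0r.
  rewrite mulSn; apply: le_trans (usub _ _) _.
  by rewrite -natr1 mulrDl mul1r; lra.
apply/cvgrPdist_le => e e0.
have e2 : 0 < e / 2 by rewrite divr_gt0.
have [_ [k k0 <-] Hk] := inf_adherent e2 hA.
pose C := \sum_(r < k) u r + u 0%N.
have C0 : 0 <= C by rewrite addr_ge0// sumr_ge0.
near=> n.
have n0 : (0 < n)%N by near: n; exact: nbhs_infty_gt.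
have n0' : 0 < n%:R :> R by rewrite ltr0n.
have Cn : C / (e / 2) <= n%:R by near: n; exact: nbhs_infty_ger.
move: Cn; rewrite ler_pdivrMr// => Cn.
rewrite distrC ger0_norm ?subr_ge0 ?Hle// lerBlDr ler_pdivrMl//.
have k0' : 0 < k%:R :> R by rewrite ltr0n.
have Hk' : u k <= k%:R * (inf A + e / 2) by rewrite -ler_pdivrMl// ltW.
have ur : u (n %% k)%N <= \sum_(r < k) u r.
  have rk : (n %% k < k)%N by rewrite ltn_mod.
  by rewrite (bigD1 (Ordinal rk))//= lerDl sumr_ge0.
have un : u n <= (n %/ k)%:R * u k + C.
  rewrite {1}(divn_eq n k); apply: le_trans (usub _ _) _.
  by have := umul (n %/ k)%N k; rewrite /C; lra.
have qk : (n %/ k)%:R * k%:R <= n%:R :> R by rewrite -natrM ler_nat leq_trunc_div.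
have iA : 0 <= inf A by apply: lb_le_inf; [case: hA|move=> x /A0].
have H1 : (n %/ k)%:R * u k <= (n %/ k)%:R * (k%:R * (inf A + e / 2)) by rewrite ler_wpM2l.
have H2 : (n %/ k)%:R * k%:R * (inf A + e / 2) <= n%:R * (inf A + e / 2).
  by rewrite ler_wpM2r// addr_ge0// ltW.
by rewrite mulrA in H1; lra.
Unshelve. all: by end_near. Qed.

End fekete.

Section finite_valued.
Context (R : realType) d (Omega : measurableType d) (Q : {finite_measure set Omega -> \bar R}).
Context (A : finType) (Y : Omega -> A).
Hypothesis mY : forall a, measurable [set w | Y w = a].

Lemma finite_valuedE (V : nmodType) (F : A -> V) w : F (Y w) = \sum_a (if Y w == a then F a else 0).
Proof. by rewrite -big_mkcond (bigD1 (Y w))//= big1 ?addr0// => a /andP[/eqP ->]; rewrite eqxx. Qed.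

Lemma finite_valued_indicE (F : A -> R) w : F (Y w) = \sum_a F a * \1_[set w | Y w = a] w.
Proof.
rewrite finite_valuedE; apply: eq_bigr => a _; rewrite indicE.
case: eqP => [ya|ya]; first by rewrite mem_set ?mulr1.
by rewrite memNset ?mulr0.
Qed.

Lemma measurable_finite_valued (F : A -> R) : measurable_fun setT (fun w => F (Y w)).
Proof.
rewrite (_ : (fun w => _) = fun w => \sum_a F a * \1_[set w | Y w = a] w).
  by apply: measurable_sum => a; apply: measurable_funM.
by apply/funext => w; exact: finite_valued_indicE.
Qed.

Lemma integrable_finite_valued (F : A -> R) : Q.-integrable setT (fun w => (F (Y w))%:E).
Proof.
rewrite (_ : (fun w => _) = fun w => (\sum_a (F a)%:E * (\1_[set w | Y w = a] w)%:E)%E).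
  apply: integrable_sum => // a _; apply: integrableZl => //.
  exact: integrable_indic.
by apply/funext => w; rewrite finite_valued_indicE -sumEFin.
Qed.

Lemma expectation_finite_valued (F : A -> R) :
  (\int[Q]_w (F (Y w))%:E = (\sum_a fine (Q [set w | Y w = a]) * F a)%:E)%E.
Proof.
under eq_integral do rewrite finite_valued_indicE -sumEFin.
rewrite (@integral_sum _ _ _ _ _ _ _ (fun a w => (F a * \1_[set w | Y w = a] w)%:E))//; last first.
  move=> a; rewrite (_ : (fun w => (_ * _)%:E) = fun w => ((F a)%:E * (\1_[set w | Y w = a] w)%:E)%E)//.
  by apply: integrableZl => //; exact: integrable_indic.
rewrite -sumEFin; apply: eq_bigr => a _.
under eq_integral do rewrite EFinM.
rewrite integralZl//; last exact: integrable_indic.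
by rewrite integral_indic// setIT EFinM fineK ?fin_num_measure// muleC.
Qed.

End finite_valued.

Lemma sum_finite_valued (R : realType) d (Omega : measurableType d) (Q : probability Omega R)
    (A : finType) (Y : Omega -> A) : (forall a, measurable [set w | Y w = a]) ->
  \sum_a fine (Q [set w | Y w = a]) = 1.
Proof.
move=> mY; have := expectation_finite_valued Q mY (fun=> 1).
rewrite integral_cst//= mul1e probability_setT => -[].
by under eq_bigr do rewrite mulr1.
Qed.

(** Apply [ln x <= x - 1] to [r a / (P a * Z)]. The weights [r] are not normalized, as the
    Donsker-Varadhan inequality requires. The last hypothesis guards against [ln 0 = 0], which would
    replace a term that should be [-oo]. *)
Lemma gibbs_finite (R : realType) (A : finType) (P r : A -> R) (Z : R) :
  (forall a, 0 <= P a) -> \sum_a P a = 1 -> (forall a, 0 <= r a) ->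
  \sum_a r a <= Z -> 0 < Z -> (forall a, 0 < P a -> 0 < r a) ->
  \sum_a P a * (ln (r a) - ln (P a)) <= ln Z.
Proof.
move=> P0 P1 r0 rZ Z0 Pr.
apply: (@le_trans _ _ (\sum_a (r a / Z - P a + P a * ln Z))); last first.
  rewrite big_split/= sumrB -!mulr_suml P1 mul1r.
  have H : (\sum_a r a) / Z <= 1 by rewrite ler_pdivrMr// mul1r.
  by lra.
apply: ler_sum => a _; have := P0 a; rewrite le_eqVlt => /predU1P[<-|Pa].
  by rewrite !mul0r subr0 addr0 divr_ge0// ltW.
have ra := Pr a Pa.
have := @le_ln1Dx R (r a / (P a * Z) - 1).
rewrite addrCA subrr addr0 => /(_ _).
rewrite ltrBrDl subrr divr_gt0 ?mulr_gt0// => /(_ isT).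
rewrite ln_div ?posrE ?mulr_gt0// lnM ?posrE// => H.
have : P a * (ln (r a) - (ln (P a) + ln Z)) <= P a * (r a / (P a * Z) - 1) by rewrite ler_wpM2l.
have -> : P a * (r a / (P a * Z) - 1) = r a / Z - P a by field; rewrite !gt_eqF.
by rewrite !mulrBr mulrDr; lra.
Qed.

Lemma X1n_mkseq (A : Type) n (w : int -> A) : X1n n w = mkseq (fun i => w (Posz i.+1)) n :> seq A.
Proof.
apply: (@eq_from_nth _ (w 0)); first by rewrite size_tuple size_mkseq.
move=> i; rewrite size_tuple => iN.
by rewrite nth_mkseq// -(tnth_nth _ (X1n n w) (Ordinal iN)) tnth_X1n.
Qed.

Lemma sum_cat_tuple (V : nmodType) (A : finType) (F : seq A -> V) m n :
  \sum_(c : (m + n).-tuple A) F c = \sum_(a : m.-tuple A) \sum_(b : n.-tuple A) F (a ++ b).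
Proof.
rewrite pair_big/= (reindex (fun ab : m.-tuple A * n.-tuple A => cat_tuple ab.1 ab.2))//=.
have tP (c : (m + n).-tuple A) : size (take m c) == m by rewrite size_takel// size_tuple leq_addr.
have dP (c : (m + n).-tuple A) : size (drop m c) == n by rewrite size_drop size_tuple addKn.
exists (fun c => (Tuple (tP c), Tuple (dP c))).
  move=> [a b] _; congr (_, _); apply/val_inj => /=.
    by rewrite take_size_cat ?size_tuple.
  by rewrite drop_size_cat ?size_tuple.
by move=> c _; apply/val_inj => /=; rewrite cat_take_drop.
Qed.

Section block_entropy.
Context (R : realType) (m : nat) (Q : probability (apath m) R).
Hypothesis stQ : stationary Q.

Lemma measurable_cylinder n (a : n.-tuple 'I_m.+1) :
  measurable [set w : apath m | X1n n w = a].
Proof.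
rewrite (_ : [set _ | _] = \bigcap_(i : nat)
   [set w : apath m | forall h : (i < n)%N, w (Posz i.+1) = tnth a (Ordinal h)]).
  apply: bigcapT_measurable => i; case: (pselect (i < n)%N) => h; last first.
    rewrite (_ : [set _ | _] = setT)//; apply/seteqP; split => // w _ /= h'.
    by [].
  rewrite (_ : [set _ | _] = [set w : apath m | [set tnth a (Ordinal h)] (w (Posz i.+1))]).
    exact: measurable_coord.
  apply/seteqP; split => w /= H; first exact: H.
  by move=> h'; rewrite H; congr tnth; exact/val_inj.
apply/seteqP; split => w /=.
  by move=> <- i _ h; rewrite tnth_X1n.
move=> H; apply: eq_from_tnth => i; rewrite tnth_X1n (H i I (ltn_ord i)).
by congr tnth; exact/val_inj.
Qed.

(** Defined on sequences, so that it applies directly to [take i c] and [drop i c]. *)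
Definition cylinder_prob (s : seq 'I_m.+1) : R :=
  fine (Q [set w : apath m | mkseq (fun i => w (Posz i.+1)) (size s) = s]).

Lemma cylinder_probE n (a : n.-tuple 'I_m.+1) : cylinder_prob a = fine (cylP Q a).
Proof.
rewrite /cylinder_prob /cylP; congr (fine (Q _)); apply/seteqP; split => w /=;
  rewrite size_tuple -X1n_mkseq; [exact: val_inj|by move=> ->].
Qed.

Lemma cylinder_prob_ge0 s : 0 <= cylinder_prob s.
Proof. exact: fine_ge0. Qed.

Lemma cylinder_prob_le1 n (a : n.-tuple 'I_m.+1) : cylinder_prob a <= 1.
Proof.
rewrite cylinder_probE -lee_fin fineK ?fin_num_measure//; last exact: measurable_cylinder.
by apply: probability_le1; exact: measurable_cylinder.
Qed.

Lemma sum_cylinder_prob n : \sum_(a : n.-tuple 'I_m.+1) cylinder_prob a = 1.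
Proof.
rewrite -[RHS](sum_finite_valued Q (@measurable_cylinder n)).
by apply: eq_bigr => a _; rewrite cylinder_probE.
Qed.

Lemma expectation_block n (F : n.-tuple 'I_m.+1 -> R) :
  (\int[Q]_w (F (X1n n w))%:E = (\sum_(a : n.-tuple 'I_m.+1) cylinder_prob a * F a)%:E)%E.
Proof.
rewrite (expectation_finite_valued Q (@measurable_cylinder n)).
by congr EFin; apply: eq_bigr => a _; rewrite cylinder_probE.
Qed.

Lemma measurable_shifted_cylinder j n (a : n.-tuple 'I_m.+1) :
  measurable [set w : apath m | X1n n (iter j (@shift _) w) = a].
Proof.
have := @measurable_iter_shift _ (@setT (set 'I_m.+1)) j measurableT _ (measurable_cylinder a).
by rewrite setTI.
Qed.

Lemma shifted_cylinder_prob j n (a : n.-tuple 'I_m.+1) :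
  fine (Q [set w : apath m | X1n n (iter j (@shift _) w) = a]) = cylinder_prob a.
Proof.
by rewrite cylinder_probE /cylP -(stationary_iter stQ j (measurable_cylinder a)).
Qed.

Lemma expectation_shifted_block j n (F : n.-tuple 'I_m.+1 -> R) :
  (\int[Q]_w (F (X1n n (iter j (@shift _) w)))%:E = (\sum_(a : n.-tuple 'I_m.+1) cylinder_prob a * F a)%:E)%E.
Proof.
rewrite (expectation_finite_valued Q (Y := fun w => X1n n (iter j (@shift _) w))
  (@measurable_shifted_cylinder j n)).
by congr EFin; apply: eq_bigr => a _; rewrite shifted_cylinder_prob.
Qed.

Lemma block_entropyE n :
  block_entropy Q n = - \sum_(a : n.-tuple 'I_m.+1) cylinder_prob a * ln (cylinder_prob a).
Proof. by congr (- _); apply: eq_bigr => a _; rewrite cylinder_probE. Qed.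

Lemma block_entropy_ge0 n : 0 <= block_entropy Q n.
Proof.
rewrite block_entropyE oppr_ge0; apply: sumr_le0 => a _.
by rewrite mulr_ge0_le0 ?cylinder_prob_ge0// ln_le0// cylinder_prob_le1.
Qed.

(** Gibbs' inequality against the product of the laws of prefix and suffix; by stationarity the
    suffix has the law of the first [j] letters. A cylinder of positive probability has prefix and
    suffix of positive probability, so the logarithm of the product splits. *)
Lemma block_entropy_subadditive i j :
  block_entropy Q (i + j) <= block_entropy Q i + block_entropy Q j.
Proof.
pose r (c : seq 'I_m.+1) := cylinder_prob (take i c) * cylinder_prob (drop i c).
have catE (w : apath m) : X1n (i + j) w = X1n i w ++ X1n j (iter i (@shift _) w) :> seq _.
  by rewrite -X1n_cat addnC.
have takeE (w : apath m) : take i (X1n (i + j) w) = X1n i w.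
  by rewrite catE take_size_cat ?size_tuple.
have dropE (w : apath m) : drop i (X1n (i + j) w) = X1n j (iter i (@shift _) w).
  by rewrite catE drop_size_cat ?size_tuple.
have Etake : \sum_(c : (i + j).-tuple 'I_m.+1) cylinder_prob c * ln (cylinder_prob (take i c)) =
    - block_entropy Q i.
  apply: EFin_inj; rewrite -expectation_block block_entropyE opprK -expectation_block.
  by apply: eq_integral => w _; rewrite takeE.
have Edrop : \sum_(c : (i + j).-tuple 'I_m.+1) cylinder_prob c * ln (cylinder_prob (drop i c)) =
    - block_entropy Q j.
  apply: EFin_inj; rewrite -expectation_block block_entropyE opprK -(expectation_shifted_block i).
  by apply: eq_integral => w _; rewrite dropE.
have pos (c : (i + j).-tuple 'I_m.+1) : 0 < cylinder_prob c ->
    0 < cylinder_prob (take i c) /\ 0 < cylinder_prob (drop i c).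
  move=> c0; have tP : size (take i c) == i by rewrite size_takel// size_tuple leq_addr.
  have dP : size (drop i c) == j by rewrite size_drop size_tuple addKn.
  split; apply: lt_le_trans c0 _.
    rewrite -[take i c]/(tval (Tuple tP)) !cylinder_probE.
    apply: fine_le; rewrite ?fin_num_measure//; try exact: measurable_cylinder.
    apply: le_measure; rewrite ?inE; try exact: measurable_cylinder.
    by move=> w /= cE; apply/val_inj => /=; rewrite -cE takeE.
  rewrite -[drop i c]/(tval (Tuple dP)) -(shifted_cylinder_prob i (Tuple dP)) cylinder_probE.
  apply: fine_le; rewrite ?fin_num_measure//; try exact: measurable_cylinder.
    exact: measurable_shifted_cylinder.
  apply: le_measure; rewrite ?inE; try exact: measurable_cylinder.
    exact: measurable_shifted_cylinder.
  by move=> w /= cE; apply/val_inj => /=; rewrite -cE dropE.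
have := @gibbs_finite R _ (fun c : (i + j).-tuple 'I_m.+1 => cylinder_prob c) (fun c => r c) 1.
rewrite ln1 => H.
have : \sum_(c : (i + j).-tuple 'I_m.+1)
    cylinder_prob c * (ln (r c) - ln (cylinder_prob c)) <= 0.
  apply: H => //; [by move=> c; exact: cylinder_prob_ge0|exact: sum_cylinder_prob| | |].
  - by move=> c; rewrite mulr_ge0// cylinder_prob_ge0.
  - rewrite (sum_cat_tuple r) (eq_bigr (fun a : i.-tuple 'I_m.+1 => cylinder_prob a)).
      by rewrite sum_cylinder_prob.
    move=> a _; rewrite -[RHS]mulr1 -(sum_cylinder_prob j) mulr_sumr; apply: eq_bigr => b _.
    by rewrite /r take_size_cat ?size_tuple// drop_size_cat ?size_tuple.
  - by move=> c /pos[? ?]; exact: mulr_gt0.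
rewrite (eq_bigr (fun c : (i + j).-tuple 'I_m.+1 =>
   cylinder_prob c * ln (cylinder_prob (take i c)) +
   cylinder_prob c * ln (cylinder_prob (drop i c)) -
   cylinder_prob c * ln (cylinder_prob c))); last first.
  move=> c _; rewrite -mulrDr -mulrBr.
  have := cylinder_prob_ge0 c; rewrite le_eqVlt => /predU1P[<-|c0]; first by rewrite !mul0r.
  by have [? ?] := pos c c0; rewrite lnM.
rewrite sumrB big_split/= Etake Edrop -[X in _ - X]opprK -block_entropyE.
by lra.
Qed.

Lemma entropy_rate_exists : exists H : R, entropy_rate Q H /\
  forall n, (0 < n)%N -> H <= n%:R^-1 * block_entropy Q n.
Proof. exact: (subadditive_cvg block_entropy_ge0 block_entropy_subadditive). Qed.

End block_entropy.

(** * Quantized processes and masses of boxes *)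

Section quantized_process.
Context (R : realType) d (T : measurableType d) (m : nat) (cell : T -> 'I_m.+1).
Hypothesis mcell : forall a, measurable (cell @^-1` [set a]).
Context (P : probability (Xpath T) R).

Lemma measurable_cell_preimage (B : set 'I_m.+1) : measurable (cell @^-1` B).
Proof.
rewrite (_ : cell @^-1` B = \bigcup_(a in B) (cell @^-1` [set a])).
  by apply: fin_bigcup_measurable => //; exact: finite_finset.
apply/seteqP; split => x /=; first by exists (cell x).
by move=> [a Ba /= ->].
Qed.

Definition quantize (w : Xpath T) : apath m := fun i => cell (w i).

(* The measurability proof is an argument so that the measure instance can be inferred. *)
Definition quantized of (forall a, measurable (cell @^-1` [set a])) : set (apath m) -> \bar R :=
  pushforward P quantize.

Lemma measurable_quantize : measurable_fun setT quantize.
Proof.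
apply: measurable_to_path => i B _.
exact: (@measurable_coord T measurable i (cell @^-1` B) (measurable_cell_preimage B)).
Qed.

Let quantized0 : (quantized mcell) set0 = 0%E.
Proof. by rewrite /quantized /pushforward preimage_set0 measure0. Qed.

Let quantized_ge0 A : (0 <= (quantized mcell) A)%E.
Proof. by rewrite /quantized /pushforward; exact: measure_ge0. Qed.

Let quantized_sigma_additive : semi_sigma_additive (quantized mcell).
Proof. by apply: measure_semi_sigma_additive; exact: measurable_quantize. Qed.

HB.instance Definition _ := isMeasure.Build _ _ _ (quantized mcell)
  quantized0 quantized_ge0 quantized_sigma_additive.

Let quantized_setT : (quantized mcell) setT = 1%E.
Proof. by rewrite /quantized /pushforward preimage_setT; exact: probability_setT. Qed.

HB.instance Definition _ := Measure_isProbability.Build _ _ _ (quantized mcell) quantized_setT.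

Lemma stationary_quantized : stationary P -> stationary (quantized mcell).
Proof.
move=> stP B mB; rewrite /= /quantized /pushforward.
have mB' : measurable (quantize @^-1` B).
  by rewrite -[X in measurable X]setTI; exact: measurable_quantize.
by rewrite -(stP _ mB').
Qed.

Lemma ergodic_quantized : ergodic P -> ergodic (quantized mcell).
Proof.
move=> ergP B mB invB; rewrite /= /quantized /pushforward; apply: ergP.
  by rewrite -[X in measurable X]setTI; exact: measurable_quantize.
by rewrite -[in RHS]invB.
Qed.

Lemma X1n_quantize n (w : Xpath T) : X1n n (quantize w) = map_tuple cell (X1n n w).
Proof. by apply: eq_from_tnth => i; rewrite tnth_X1n tnth_map tnth_X1n. Qed.

End quantized_process.

Section cells.
Context (R : realType) d (T : measurableType d) (mu : {finite_measure set T -> \bar R}).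
Context (m : nat) (cell : T -> 'I_m.+1).
Hypothesis mcell : forall a, measurable (cell @^-1` [set a]).

Definition cell_mass (a : 'I_m.+1) : R := fine (mu (cell @^-1` [set a])).

Definition box_mass n (a : n.-tuple 'I_m.+1) : R := \prod_(i < n) cell_mass (tnth a i).

Lemma cell_mass_ge0 a : 0 <= cell_mass a. Proof. exact: fine_ge0. Qed.

Lemma box_mass_ge0 n (a : n.-tuple 'I_m.+1) : 0 <= box_mass a.
Proof. by apply: prodr_ge0 => i _; exact: cell_mass_ge0. Qed.

Lemma measurable_box n (a : n.-tuple 'I_m.+1) :
  measurable [set t : n.-tuple T | map_tuple cell t = a].
Proof.
rewrite (_ : [set _ | _] = \bigcap_(i in [set: 'I_n])
   ((fun t => tnth t i) @^-1` (cell @^-1` [set tnth a i]))).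
  apply: fin_bigcap_measurable; first exact: finite_finset.
  by move=> i _; rewrite -[X in measurable X]setTI; exact: measurable_tnth.
apply/seteqP; split => t /=; first by move=> <- i _; rewrite /= tnth_map.
by move=> H; apply: eq_from_tnth => i; rewrite tnth_map; exact: H.
Qed.

Lemma mupow_box n (a : n.-tuple 'I_m.+1) :
  mupow mu n [set t : n.-tuple T | map_tuple cell t = a] = (box_mass a)%:E.
Proof.
elim: n a => [|n IH] a.
  rewrite /box_mass big_ord0 /= diracE mem_set//=.
  by rewrite (tuple0 a); exact/val_inj.
rewrite /= /mupowS /pushforward.
rewrite (_ : _ @^-1` _ = (cell @^-1` [set thead a]) `*`
   [set t : n.-tuple T | map_tuple cell t = [tuple of behead a]]); last first.
  apply/seteqP; split => -[x t] /=.
    by move=> <-; split; [rewrite /thead (tnth_nth (cell x))|apply/val_inj].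
  move=> [xa ta]; apply/val_inj; rewrite [in RHS](tuple_eta a) /= xa.
  by congr cons; exact: (congr1 val ta).
rewrite product_measure1E//; last exact: measurable_box.
rewrite [X in (_ * X)%E]IH /box_mass big_ord_recl EFinM.
congr (_ * _)%E; first by rewrite /cell_mass fineK ?fin_num_measure.
by congr EFin; apply: eq_bigr => i _; congr cell_mass; rewrite [in RHS](tuple_eta a) tnthS.
Qed.

Lemma integral_mupow_cells n (F : n.-tuple 'I_m.+1 -> R) :
  (\int[mupow mu n]_t (F (map_tuple cell t))%:E =
   (\sum_(a : n.-tuple 'I_m.+1) box_mass a * F a)%:E)%E.
Proof.
rewrite (expectation_finite_valued (mupow mu n) (@measurable_box n)).
by congr EFin; apply: eq_bigr => a _; rewrite [X in fine X]mupow_box.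
Qed.

Lemma measurable_fun_cells n (F : n.-tuple 'I_m.+1 -> R) :
  measurable_fun setT (fun t : n.-tuple T => F (map_tuple cell t)).
Proof. exact: (measurable_finite_valued (@measurable_box n)). Qed.

Context (P : probability (Xpath T) R).

Lemma cylP_quantized n (a : n.-tuple 'I_m.+1) :
  cylP (quantized P mcell) a = P [set w : Xpath T | map_tuple cell (X1n n w) = a].
Proof.
rewrite /cylP /= /quantized /pushforward; congr (P _).
by apply/seteqP; split => w /=; rewrite X1n_quantize.
Qed.

(** Absolute continuity on boxes. It keeps quotients and logarithms of box masses away from the
    default values [x / 0 = 0] and [ln 0 = 0]. *)
Lemma box_mass_gt0 n (p : n.-tuple T -> \bar R) (a : n.-tuple 'I_m.+1) :
  is_density mu P p -> 0 < cylinder_prob (quantized P mcell) a -> 0 < box_mass a.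
Proof.
move=> dp; rewrite cylinder_probE cylP_quantized => Pa.
rewrite lt_neqAle box_mass_ge0 andbT; apply/eqP => a0.
have [p0 mp _] := dp.
have := density_integral dp (g := fun t => (\1_[set t | map_tuple cell t = a] t)%:E).
have mB := measurable_box a.
move=> /(_ _ _) H; move: Pa.
suff -> : P [set w : Xpath T | map_tuple cell (X1n n w) = a] = 0%E by rewrite ltxx.
transitivity (\int[P]_w (\1_[set t | map_tuple cell t = a] (X1n n w))%:E)%E.
  have mE : measurable [set w : Xpath T | map_tuple cell (X1n n w) = a].
    have := @measurable_X1n d T n measurableT _ mB; by rewrite setTI.
  by have := @integral_indic _ _ _ P setT measurableT _ mE; rewrite setIT => <-.
rewrite H//; last exact/measurable_EFinP.
rewrite (@ge0_negligible_integral _ _ _ _ setT [set t | map_tuple cell t = a])//.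
- rewrite integral0_eq// => t [_ /= nta]; rewrite indicE memNset// mul0e//.
- by apply: emeasurable_funM => //; exact/measurable_EFinP.
- by move=> t _; rewrite mule_ge0.
- by apply: (etrans (mupow_box a)); rewrite -a0.
Qed.

End cells.

Section quantized_entropy.
Context (R : realType) d (T : measurableType d) (mu : {finite_measure set T -> \bar R}).
Context (m : nat) (cell : T -> 'I_m.+1).
Hypothesis mcell : forall a, measurable (cell @^-1` [set a]).
Context (P : probability (Xpath T) R).
Hypothesis stP : stationary P.
Context (n : nat) (p : n.-tuple T -> \bar R).
Hypothesis dp : is_density mu P p.

Let prob (s : seq 'I_m.+1) := cylinder_prob (quantized P mcell) s.

(* The Donsker-Varadhan inequality for the test function [Phi]. *)
Lemma quantized_entropy_le (Phi : n.-tuple 'I_m.+1 -> R) :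
  block_entropy (quantized P mcell) n +
    \sum_(a : n.-tuple 'I_m.+1) prob a * ln (box_mass mu cell a) <=
  ln (\sum_(a : n.-tuple 'I_m.+1) box_mass mu cell a * expR (Phi a)) -
    \sum_(a : n.-tuple 'I_m.+1) prob a * Phi a.
Proof.
set Z := \sum_(a : n.-tuple _) _ * expR _.
have prob0 (a : n.-tuple 'I_m.+1) : 0 <= prob a by exact: cylinder_prob_ge0.
have prob1 : \sum_(a : n.-tuple 'I_m.+1) prob a = 1 by exact: sum_cylinder_prob.
have box0 (a : n.-tuple 'I_m.+1) : 0 < prob a -> 0 < box_mass mu cell a.
  exact: box_mass_gt0 dp.
have Z0 : 0 < Z.
  rewrite lt_neqAle eq_sym; apply/andP; split; last first.
    by apply: sumr_ge0 => a _; rewrite mulr_ge0 ?expR_ge0 ?box_mass_ge0.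
  apply/eqP => Z0; have := oner_neq0 R; rewrite -prob1; apply/negP/negPn.
  rewrite big1// => a _; apply/eqP; rewrite eq_le prob0 andbT leNgt; apply/negP => pa.
  have : box_mass mu cell a * expR (Phi a) <= Z.
    rewrite /Z (bigD1 a)//= lerDl; apply: sumr_ge0 => b _.
    by rewrite mulr_ge0 ?expR_ge0 ?box_mass_ge0.
  by rewrite Z0 leNgt mulr_gt0 ?expR_gt0// box0.
have := @gibbs_finite R _ (fun a : n.-tuple 'I_m.+1 => prob a)
  (fun a => box_mass mu cell a * expR (Phi a)) Z prob0 prob1.
have r0 (a : n.-tuple 'I_m.+1) : 0 <= box_mass mu cell a * expR (Phi a).
  by rewrite mulr_ge0 ?expR_ge0 ?box_mass_ge0.
move=> /(_ r0 (lexx _) Z0) H.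
have : \sum_(a : n.-tuple 'I_m.+1) prob a * (ln (box_mass mu cell a * expR (Phi a)) - ln (prob a)) <= ln Z.
  by apply: H => a pa; rewrite mulr_gt0 ?expR_gt0// box0.
rewrite (eq_bigr (fun a : n.-tuple 'I_m.+1 => prob a * ln (box_mass mu cell a) +
    prob a * Phi a - prob a * ln (prob a))); last first.
  move=> a _; rewrite -mulrDr -mulrBr.
  have := prob0 a; rewrite le_eqVlt => /predU1P[<-|pa]; first by rewrite !mul0r.
  by rewrite lnM ?posrE ?expR_gt0 ?box0// expRK.
rewrite sumrB big_split/= block_entropyE -/prob.
by lra.
Qed.

(** The logarithm of the product splits on boxes of positive probability, and stationarity gives
    every coordinate the same marginal. The mean is thus exactly linear in [n]. *)
Lemma expectation_ln_box_mass :
  \sum_(a : n.-tuple 'I_m.+1) prob a * ln (box_mass mu cell a) =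
  n%:R * \sum_(a : 'I_m.+1) fine (P [set w : Xpath T | cell (w 1) = a]) * ln (cell_mass mu cell a).
Proof.
rewrite (eq_bigr (fun a : n.-tuple 'I_m.+1 => prob a * \sum_(i < n) ln (cell_mass mu cell (tnth a i)))); last first.
  move=> a _; have := cylinder_prob_ge0 (quantized P mcell) a.
  rewrite le_eqVlt => /predU1P[|pa]; first by rewrite /prob => <-; rewrite !mul0r.
  congr (_ * _); have /= := box_mass_gt0 dp pa.
  rewrite /box_mass; elim/big_rec2: _ => [_|i y z _ IH]; first by rewrite ln1.
  have := cell_mass_ge0 mu cell (tnth a i); rewrite le_eqVlt => /predU1P[<-|c0].
    by rewrite mul0r ltxx.
  rewrite pmulr_rgt0// => z0; rewrite -IH// lnM//.
apply: EFin_inj.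
rewrite -(expectation_block _ (fun a : n.-tuple 'I_m.+1 => \sum_(i < n) ln (cell_mass mu cell (tnth a i)))).
under eq_integral do rewrite -sumEFin.
have mc i (a : 'I_m.+1) : measurable [set w : apath m | w i = a].
  exact: (@measurable_coord _ (@setT (set 'I_m.+1)) i [set a]).
rewrite (@integral_sum _ _ _ _ _ _ _ (fun (i : 'I_n) (w : apath m) => (ln (cell_mass mu cell (tnth (X1n n w) i)))%:E))//; last first.
  move=> i; apply: (@eq_integrable _ _ _ _ setT measurableT
    (fun w : apath m => (ln (cell_mass mu cell (w i.+1)))%:E)).
    by move=> w _; rewrite tnth_X1n.
  exact: (@integrable_finite_valued _ _ _ _ _ (fun w : apath m => w i.+1) (mc _) (fun a => ln (cell_mass mu cell a))).
rewrite (eq_bigr (fun=> (\sum_(a : 'I_m.+1) fine (P [set w : Xpath T | cell (w 1) = a]) * ln (cell_mass mu cell a))%:E)).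
  by rewrite sumr_const card_ord EFinM mule_natl.
move=> i _; under eq_integral do rewrite tnth_X1n.
rewrite (@expectation_finite_valued _ _ _ _ _ (fun w : apath m => w i.+1) (mc _) (fun a => ln (cell_mass mu cell a))).
congr EFin; apply: eq_bigr => a _; congr (fine _ * _).
have stQ := stationary_quantized mcell stP.
transitivity (quantized P mcell [set w : apath m | w 1 = a]); last by [].
apply: (etrans _ (stationary_iter stQ i (mc 1 a))); congr (quantized P mcell _).
by apply/seteqP; split => w /=; rewrite iter_shiftE => <-; congr (w _).
Qed.

End quantized_entropy.

(** * Approximation by functions of the cells *)

Section approximation_by_cells.
Context (R : realType) d (T : measurableType d) (k : nat -> nat) (cell : forall l, T -> 'I_(k l).+1).
Hypothesis Fcell : finite_filtration cell.
Context (n : nat) (lam : {finite_measure set (n.-tuple T) -> \bar R}).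

Definition same_cells l (x y : n.-tuple T) := map_tuple (cell l) x = map_tuple (cell l) y.

Lemma same_cellsP l x y : same_cells l x y <-> forall i, cell l (tnth x i) = cell l (tnth y i).
Proof.
split=> [H i|H]; first by have := congr1 (fun t => tnth t i) H; rewrite !tnth_map.
by apply: eq_from_tnth => i; rewrite !tnth_map.
Qed.

Lemma same_cells_refine l l' x y : (l <= l')%N -> same_cells l' x y -> same_cells l x y.
Proof.
move=> ll' /same_cellsP H; apply/same_cellsP => i; move: (H i).
move: (tnth x i) (tnth y i) => {H}x {}y.
elim: l' ll' => [|l' IH]; first by rewrite leqn0 => /eqP ->.
rewrite leq_eqVlt => /predU1P[-> //|]; rewrite ltnS => ll' H.
by apply: IH => //; case: Fcell => _ _ _ /(_ l' x y H).
Qed.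

(** The unions of level-[l] boxes, encoded by invariance; refinement of the partitions then makes
    the notion monotone in [l]. *)
Definition saturated l (C : set (n.-tuple T)) := forall x y, same_cells l x y -> C x -> C y.

Lemma saturated_refine l l' C : (l <= l')%N -> saturated l C -> saturated l' C.
Proof. by move=> ll' H x y /(same_cells_refine ll'); exact: H. Qed.

Definition symdiff (A C : set (n.-tuple T)) := (A `\` C) `|` (C `\` A).

Lemma measurable_symdiff A C : measurable A -> measurable C -> measurable (symdiff A C).
Proof. by move=> mA mC; apply: measurableU; exact: measurableD. Qed.

Definition approximable (A : set (n.-tuple T)) := measurable A /\
  forall eps : R, 0 < eps -> exists l C,
    [/\ saturated l C, measurable C & (lam (symdiff A C) <= eps%:E)%E].

Lemma approximable_saturated l C : saturated l C -> measurable C -> approximable C.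
Proof.
move=> sC mC; split => // eps e0; exists l, C; split => //.
by rewrite /symdiff setDv setU0 measure0 lee_fin ltW.
Qed.

Lemma approximableC A : approximable A -> approximable (~` A).
Proof.
move=> [mA H]; split; first exact: measurableC.
move=> eps e0; have [l [C [sC mC AC]]] := H eps e0; exists l, (~` C); split.
- by move=> x y xy nCx Cy; apply: nCx; apply: sC Cy; exact/esym.
- exact: measurableC.
- apply: le_trans AC; apply: le_measure; rewrite ?inE; try exact: measurable_symdiff.
    by apply: measurable_symdiff; exact: measurableC.
  by move=> x [[nA /contrapT C_x]|[nC /contrapT A_x]]; [right|left].
Qed.

Lemma approximableU A B : approximable A -> approximable B -> approximable (A `|` B).
Proof.
move=> [mA HA] [mB HB]; split; first exact: measurableU.
move=> eps e0; have e2 : 0 < eps / 2 by rewrite divr_gt0.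
have [l [C [sC mC AC]]] := HA _ e2; have [l' [D [sD mD BD]]] := HB _ e2.
exists (maxn l l'), (C `|` D); split.
- move=> x y xy [Cx|Dx].
    by left; exact: (saturated_refine (leq_maxl l l') sC xy Cx).
  by right; exact: (saturated_refine (leq_maxr l l') sD xy Dx).
- exact: measurableU.
- rewrite (splitr eps) EFinD; apply: le_trans (leeD AC BD).
  have mAC := measurable_symdiff mA mC; have mBD := measurable_symdiff mB mD.
  apply: le_trans (measureU2 lam mAC mBD); apply: le_measure; rewrite ?inE.
  + by apply: measurable_symdiff; exact: measurableU.
  + exact: measurableU.
  + move=> x [[[Ax|Bx] /not_orP[nC nD]]|[[Cx|Dx] /not_orP[nA nB]]].
    * by left; left.
    * by right; left.
    * by left; right.
    * by right; right.
Qed.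

(** Since [lam] is finite, a finite partial union misses only a small measure, and finitely many
    sets admit a common level. *)
Lemma approximable_bigcup (F : nat -> set (n.-tuple T)) :
  (forall i, approximable (F i)) -> approximable (\bigcup_i F i).
Proof.
move=> aF; have mF i : measurable (F i) by case: (aF i).
have mU : measurable (\bigcup_i F i) by exact: bigcupT_measurable.
split => // eps e0.
pose G N := \bigcup_(i < N) F i.
have GS N : G N.+1 = G N `|` F N by rewrite /G bigcup_mkord big_ord_recr/= -bigcup_mkord.
have aG N : approximable (G N).
  elim: N => [|N IH]; last by rewrite GS; exact: approximableU.
  by rewrite /G bigcup_mkord big_ord0; exact: (@approximable_saturated 0).
have mG N : measurable (G N) by case: (aG N).
have e2 : 0 < eps / 2 by rewrite divr_gt0.
have cv : lam (\bigcup_i F i `\` G N) @[N --> \oo] --> 0%E.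
  have <- : lam (\bigcap_N (\bigcup_i F i `\` G N)) = 0%E.
    rewrite (_ : \bigcap_N _ = set0) ?measure0//; apply/seteqP; split => // x Hx.
    have [[i _ Fi] _] := Hx 0%N I; have [_] := Hx i.+1 I; apply.
    by exists i => /=.
  apply: nonincreasing_cvg_mu.
  - by rewrite -ge0_fin_numE// fin_num_measure//; exact: measurableD.
  - by move=> N; exact: measurableD.
  - by apply: bigcapT_measurable => N; exact: measurableD.
  - move=> a b ab; apply/subsetPset => x [Ux nG]; split => // -[i /= ia Fi].
    by apply: nG; exists i => //=; exact: leq_trans ab.
have [N HN] : exists N, (lam (\bigcup_i F i `\` G N) < (eps / 2)%:E)%E.
  have : \forall N \near \oo, (lam (\bigcup_i F i `\` G N) < (eps / 2)%:E)%E.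
    by apply: cvge_near_lt cv _; rewrite lte_fin.
  by case=> N _ H; exists N; exact: (H N (leqnn _)).
have [_ /(_ _ e2)[l [C [sC mC GC]]]] := aG N; exists l, C; split => //.
rewrite (splitr eps) EFinD; apply: le_trans (leeD (ltW HN) GC).
have mUG : measurable (\bigcup_i F i `\` G N) by exact: measurableD.
have mGC := measurable_symdiff (mG N) mC.
apply: le_trans (measureU2 lam mUG mGC); apply: le_measure; rewrite ?inE.
- exact: measurable_symdiff.
- exact: measurableU.
- move=> x [[Ux nC]|[Cx nU]].
    by have [Gx|nG] := pselect (G N x); [right; left|left].
  right; right; split => // -[i _ Fi]; apply: nU; by exists i.
Qed.

Lemma approximable_sigma_algebra : sigma_algebra setT approximable.
Proof.
split; first exact: (@approximable_saturated 0).
- by move=> A aA; rewrite setTD; exact: approximableC.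
- exact: approximable_bigcup.
Qed.

(** Minimality is used twice: the measurable sets of tuples are generated by the coordinates, and
    those of [T] by the cells of all levels. *)
Lemma measurable_approximable A : measurable A -> approximable A.
Proof.
move=> mA; have coordP i (B : set T) : measurable B -> approximable ((fun t => tnth t i) @^-1` B).
  case: Fcell => _ _ mcell _ /(_ B)[H _] /H; apply: (@smallest_sub _ _ _
    [set B | approximable ((fun t => tnth t i) @^-1` B)]).
    split => [|D /= aD|F aF /=].
    - by rewrite /= preimage_set0; exact: (@approximable_saturated 0).
    - by rewrite setTD preimage_setC; exact: approximableC.
    - by rewrite preimage_bigcup; exact: approximable_bigcup.
  move=> _ [l [a ->]] /=; apply: (@approximable_saturated l).
    by move=> x y /same_cellsP /(_ i) /= ->.
  by rewrite -[X in measurable X]setTI; exact: measurable_tnth.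
move: A mA; apply: smallest_sub; first exact: approximable_sigma_algebra.
rewrite -bigcup_seq; apply: bigcup_sub => i _ _ [B mB <-].
by rewrite setTI; exact: coordP.
Qed.

End approximation_by_cells.

(** The sum counts the thresholds below [y] and equals its integer part. *)
Lemma sum_floor_bounds (R : realType) (M : nat) (y : R) : 0 <= y <= M%:R ->
  y - 1 <= \sum_(j < M) (nat_of_bool (j.+1%:R <= y)%R)%:R <= y.
Proof.
elim: M y => [|M IH] y /andP[y0 yM].
  by rewrite big_ord0; apply/andP; split; lra.
rewrite big_ord_recr/=; have [yM'|My] := leP y M%:R.
  have -> : (M.+1%:R <= y) = false.
    by apply/negbTE; rewrite -ltNge (le_lt_trans yM')// ltr_nat.
  by rewrite addr0; apply: IH; rewrite y0.
rewrite (eq_bigr (fun=> 1)) => [|j _]; last first.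
  have -> // : j.+1%:R <= y; apply: le_trans (ltW My).
  by rewrite ler_nat.
have e : M.+1%:R = M%:R + 1 :> R by rewrite natr1.
rewrite sumr_const card_ord e; rewrite e in yM.
by case: (lerP (M%:R + 1) y) => H; rewrite ?mulr1n ?mulr0n; apply/andP; split; lra.
Qed.

Section function_approximation.
Context (R : realType) d (T : measurableType d) (k : nat -> nat) (cell : forall l, T -> 'I_(k l).+1).
Hypothesis Fcell : finite_filtration cell.
Context (n : nat) (lam : {finite_measure set (n.-tuple T) -> \bar R}).

(** Every label occurs, so a representative can be chosen in each cell and [phi] evaluated there. *)
Lemma same_cells_factor l (phi : n.-tuple T -> R) :
  (forall x y, same_cells cell l x y -> phi x = phi y) ->
  exists Phi : n.-tuple 'I_(k l).+1 -> R, forall x, phi x = Phi (map_tuple (cell l) x).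
Proof.
move=> H; case: Fcell => _ /(_ l) /choice[s sP] _ _ _.
exists (fun a => phi (map_tuple s a)) => x; apply: H.
by apply/same_cellsP => i; rewrite !tnth_map sP.
Qed.

(** Replace [g] by a staircase of step [1 / N], which is an average of indicators of level sets, and
    each level set by a saturated set. The form of [phi] as a sum of indicators keeps it between 0
    and [K]. *)
Lemma approximation_by_cell_functions (g : n.-tuple T -> R) (K : nat) (eps : R) :
  measurable_fun setT g -> (forall t, 0 <= g t <= K%:R) -> 0 < eps ->
  exists l (phi : n.-tuple T -> R), [/\ measurable_fun setT phi,
    forall x y, same_cells cell l x y -> phi x = phi y,
    forall t, 0 <= phi t <= K%:R &
    (\int[lam]_t (`|g t - phi t|)%:E <= eps%:E)%E].
Proof.
move=> mg gK e0.
pose L := fine (lam setT); have L0 : 0 <= L by exact: fine_ge0.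
have LE : lam setT = L%:E by rewrite fineK// fin_num_measure.
(* The staircase costs [L / N <= eps / 2]. The [K * N] level sets, each with error [eta] and weight
   [1 / N], cost [K * eta <= eps / 2]; [K.+1] in [eta] avoids a zero denominator. *)
pose N := (Num.truncn (L / (eps / 2))).+1.
have N0 : 0 < N%:R :> R by rewrite ltr0n.
have LN : N%:R^-1 * L <= eps / 2.
  rewrite ler_pdivrMl// -ler_pdivrMr ?divr_gt0//.
  exact: ltW (truncnS_gt _).
have K1 : 0 < K.+1%:R :> R by rewrite ltr0n.
pose eta := eps / (2 * K.+1%:R); have eta0 : 0 < eta by rewrite divr_gt0// mulr_gt0.
pose A (j : nat) : set (n.-tuple T) := [set t | j.+1%:R <= N%:R * g t].
have mA j : measurable (A j).
  rewrite (_ : A j = (fun t => N%:R * g t) @^-1` `[j.+1%:R, +oo[).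
    rewrite -[X in measurable X]setTI.
    have mNg : measurable_fun setT (fun t => N%:R * g t) by exact: measurable_funM.
    exact: mNg.
  by apply/seteqP; split => t /=; rewrite in_itv/= andbT.
have /choice[f Hf] : forall j, exists lC : nat * set (n.-tuple T),
    [/\ saturated cell lC.1 lC.2, measurable lC.2 & (lam (symdiff (A j) lC.2) <= eta%:E)%E].
  move=> j; have [_ /(_ _ eta0)[l [C [? ? ?]]]] := measurable_approximable Fcell lam (mA j).
  by exists (l, C).
pose l := \max_(j < K * N) (f j).1.
pose phi (t : n.-tuple T) : R := N%:R^-1 * \sum_(j < K * N) \1_((f j).2) t.
have mC j : measurable (f j).2 by case: (Hf j).
have ind01 (B : set (n.-tuple T)) t : 0 <= (\1_B t : R) <= 1.
  by rewrite indicE; case: (_ \in _); rewrite /= ?lexx ?ler01.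
exists l, phi; split.
- by apply: measurable_funM => //; apply: measurable_sum => j; exact: measurable_indic.
- move=> x y xy; congr (_ * _); apply: eq_bigr => j _; rewrite !indicE.
  have sj : saturated cell l (f j).2.
    by apply: (saturated_refine Fcell (l := (f j).1)); [exact: leq_bigmax|case: (Hf j)].
  congr (nat_of_bool _)%:R; apply/idP/idP => /set_mem H; apply/mem_set; apply: sj H => //.
- move=> t; apply/andP; split.
    by rewrite mulr_ge0 ?invr_ge0// sumr_ge0.
  rewrite ler_pdivrMl// mulrC -natrM.
  apply: (@le_trans _ _ (\sum_(j < K * N) 1)).
    by apply: ler_sum => j _; case/andP: (ind01 (f j).2 t).
  by rewrite sumr_const card_ord.
have bound t : `|g t - phi t| <= N%:R^-1 + N%:R^-1 * \sum_(j < K * N) \1_(symdiff (A j) (f j).2) t.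
  have /andP[g0 gK'] := gK t.
  have : 0 <= N%:R * g t <= (K * N)%:R.
    by rewrite mulr_ge0//= natrM mulrC ler_wpM2r.
  move=> /sum_floor_bounds /andP[s1 s2].
  set s := \sum_(j < _) (_ : R) in s1 s2.
  have sE : s = \sum_(j < K * N) \1_(A j) t.
    by apply: eq_bigr => j _; rewrite indicE; congr (nat_of_bool _)%:R; apply/idP/idP => [|/set_mem//]; exact: mem_set.
  have g1 : `|g t - N%:R^-1 * s| <= N%:R^-1.
    have -> : g t - N%:R^-1 * s = N%:R^-1 * (N%:R * g t - s).
      by rewrite mulrBr mulKf// gt_eqF.
    rewrite normrM ger0_norm ?invr_ge0// -[leRHS]mulr1 ler_wpM2l ?invr_ge0//.
    by rewrite ler_norml; apply/andP; split; lra.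
  have g2 : `|N%:R^-1 * s - phi t| <= N%:R^-1 * \sum_(j < K * N) \1_(symdiff (A j) (f j).2) t.
    rewrite -mulrBr normrM ger0_norm ?invr_ge0// ler_wpM2l ?invr_ge0//.
    rewrite sE -sumrB; apply: le_trans (ler_norm_sum _ _ _) _; apply: ler_sum => j _.
    rewrite !indicE; have [At|At] := pselect (A j t); have [Ct|Ct] := pselect ((f j).2 t).
    - by rewrite (mem_set At) (mem_set Ct) subrr normr0 ler0n.
    - rewrite (mem_set At) (memNset Ct) mem_set ?subr0 ?normr1//; by left.
    - rewrite (memNset At) (mem_set Ct) mem_set ?sub0r ?normrN1//; by right.
    - by rewrite (memNset At) (memNset Ct) subrr normr0 ler0n.
  have -> : g t - phi t = (g t - N%:R^-1 * s) + (N%:R^-1 * s - phi t) by lra.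
  by apply: le_trans (ler_normD _ _) _; exact: lerD.
have mD j : measurable (symdiff (A j) (f j).2) by exact: measurable_symdiff.
apply: (@le_trans _ _ (\int[lam]_t (N%:R^-1%:E + \sum_(j < K * N) (N%:R^-1%:E * (\1_(symdiff (A j) (f j).2) t)%:E)))%E).
  apply: ge0_le_integral => //.
  - apply/measurable_EFinP; apply: measurableT_comp => //; apply: measurable_funB => //.
    by apply: measurable_funM => //; apply: measurable_sum => j; exact: measurable_indic.
  - apply: emeasurable_funD => //; apply: emeasurable_sum => j; apply: emeasurable_funM => //.
    exact/measurable_EFinP.
  - move=> t _; apply: le_trans (_ : (_ <= (N%:R^-1 + N%:R^-1 * \sum_(j < K * N) \1_(symdiff (A j) (f j).2) t)%:E)%E) _.
      by rewrite lee_fin.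
    by rewrite EFinD mulr_sumr -sumEFin.
have pos j t : (0 <= N%:R^-1%:E * (\1_(symdiff (A j) (f j).2) t)%:E :> \bar R)%E.
  by rewrite mule_ge0// lee_fin invr_ge0.
rewrite ge0_integralD//; last 2 first.
- by move=> t _; apply: sume_ge0 => j _.
- apply: emeasurable_sum => j; apply: emeasurable_funM => //; exact/measurable_EFinP.
rewrite integral_cst// [X in (_ * X)%E]LE ge0_integral_sum//; last first.
  by move=> j; apply: emeasurable_funM => //; exact/measurable_EFinP.
apply: (@le_trans _ _ ((N%:R^-1 * L)%:E + \sum_(j < K * N) (N%:R^-1 * eta)%:E)%E).
  apply: leeD => //; apply: lee_sum => j _.
  rewrite ge0_integralZl_EFin ?invr_ge0//; [|exact/measurable_EFinP].
  rewrite integral_indic// setIT EFinM lee_wpmul2l ?lee_fin ?invr_ge0//.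
  by case: (Hf j).
rewrite sumEFin sumr_const card_ord -EFinD lee_fin -[(_ * eta) *+ _]mulr_natl natrM.
have -> : K%:R * N%:R * (N%:R^-1 * eta) = K%:R * eta by field; rewrite gt_eqF.
have : K%:R * eta <= eps / 2.
  rewrite /eta invfM mulrA -[leRHS]mulr1 mulrA.
  have -> : K%:R * eps / 2 / K.+1%:R = eps / 2 * (K%:R / K.+1%:R) by field; rewrite gt_eqF.
  rewrite mulr1 -[leRHS]mulr1; apply: ler_wpM2l; first by rewrite divr_ge0// ltW.
  by rewrite ler_pdivrMr// mul1r ler_nat.
by lra.
Qed.

End function_approximation.

Section finite_measure_add.
Context d (T : measurableType d) (R : realType) (m1 m2 : {finite_measure set T -> \bar R}).

Definition finite_measure_add := measure_add m1 m2.

HB.instance Definition _ := Measure.on finite_measure_add.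

Let finite_measure_add_fin : fin_num_fun finite_measure_add.
Proof.
by move=> A mA; rewrite /finite_measure_add measure_addE fin_numD !fin_num_measure.
Qed.

HB.instance Definition _ := Measure_isFinite.Build _ _ _ finite_measure_add finite_measure_add_fin.

End finite_measure_add.

Section truncation.
Context (R : realType).

(** Clipping is done in the extended reals, so that infinite values become [K] or [- K] before
    [fine] could send them to 0. *)
Definition clip (K : R) (x : \bar R) : R := fine (maxe (- K)%:E (mine K%:E x)).

Lemma measurable_clip K : measurable_fun setT (clip K).
Proof.
apply: measurableT_comp (fine_measurable measurableT) _.
by apply: measurable_maxe => //; apply: measurable_mine.
Qed.

Lemma clip_bounds (K : R) x : 0 <= K -> - K <= clip K x <= K.
Proof.
move=> K0; rewrite /clip; case: x => [r| |] /=.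
- by rewrite -EFin_min -EFin_max/= le_max lexx/= ge_max ge_min lexx/= andbT; lra.
- by rewrite miney/= -EFin_max/= le_max lexx/= ge_max lexx andbT; lra.
- by rewrite lexx/=; lra.
Qed.

Lemma clip_EFin (K r : R) : `|r| <= K -> clip K r%:E = r.
Proof.
rewrite ler_norml => /andP[h1 h2].
by rewrite /clip -EFin_min -EFin_max/= (min_idPr h2) (max_idPr h1).
Qed.

Lemma normr_clip_le (K r : R) : 0 <= K -> `|clip K r%:E| <= `|r|.
Proof.
move=> K0; have [rK|Kr] := leP `|r| K; first by rewrite clip_EFin.
by apply: le_trans (ltW Kr); rewrite ler_norml; exact: clip_bounds.
Qed.

(** The left-hand side is [x] clipped to the interval from [exp(- K)] to [exp(K)], and only the
    lower end can raise it. *)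
Lemma expR_clip_neglog (K : R) (x : \bar R) : 0 <= K -> (0 <= x)%E ->
  ((expR (- clip K (neglog x)))%:E <= x + (expR (- K))%:E)%E.
Proof.
move=> K0; case: x => [r| |]//=; last by move=> _; rewrite addye// leey.
rewrite lee_fin le_eqVlt => /predU1P[<-|r0].
  by rewrite eqxx add0e lee_fin ler_expR /clip miney -EFin_max/= (max_idPr _)//; lra.
rewrite gt_eqF// -EFinD lee_fin /clip -EFin_min -EFin_max /=.
have re : expR (ln r) = r by rewrite lnK.
have eK := expR_ge0 (- K).
case: (leP K (- ln r)) => h1.
  have -> : Num.max (- K) K = K by apply/max_idPr; lra.
  by rewrite lerDr ltW.
case: (leP (- K) (- ln r)) => h2; first by rewrite opprK re lerDl.
rewrite opprK -{1}re; have : expR K <= expR (ln r) by rewrite ler_expR; lra.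
by lra.
Qed.

End truncation.

(** The tangent at [a] lies below the exponential, so only [a] has to be bounded above. *)
Lemma expR_le_lipschitz (R : realType) (K a b : R) : a <= K ->
  expR a <= expR b + expR K * `|b - a|.
Proof.
move=> aK; have h : 1 + (b - a) <= expR (b - a) by exact: expR_ge1Dx.
have e : expR b = expR a * expR (b - a) by rewrite -expRD addrCA subrr addr0.
have h1 : expR a * (1 + (b - a)) <= expR b by rewrite e ler_wpM2l// expR_ge0.
have h2 : expR a * `|b - a| <= expR K * `|b - a| by rewrite ler_wpM2r// ler_expR.
have h3 : expR a * - (b - a) <= expR a * `|b - a|.
  by rewrite ler_wpM2l ?expR_ge0// -normrN ler_norm.
by rewrite mulrDr mulr1 in h1; rewrite mulrN in h3; lra.
Qed.

(** * Choice of a quantization level for fixed block length *)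

Section quantization.
Context (R : realType) d (T : measurableType d) (mu : {finite_measure set T -> \bar R}).
Context (k : nat -> nat) (cell : forall l, T -> 'I_(k l).+1).
Hypothesis Fcell : finite_filtration cell.
Context (P : probability (Xpath T) R).
Context (n : nat) (p : n.-tuple T -> \bar R).
Hypothesis dp : is_density mu P p.
Hypothesis ip : P.-integrable setT (fun w => neglog (p (X1n n w))).

Lemma measurable_cell l a : measurable (cell l @^-1` [set a]).
Proof. by case: Fcell. Qed.

Let mp : measurable_fun setT p. Proof. by case: dp. Qed.
Let p0 t : (0 <= p t)%E. Proof. by case: dp. Qed.

Lemma integral_clip_cvg :
  (\int[P]_w (clip K%:R (neglog (p (X1n n w))))%:E)%E @[K --> \oo] -->
  (\int[P]_w neglog (p (X1n n w)))%E.
Proof.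
have mnp : measurable_fun setT (fun w : Xpath T => neglog (p (X1n n w))).
  exact: (measurable_fun_X1n (measurableT_comp (@measurable_neglog R) mp)).
have fin := integrable_ae measurableT ip.
have [] := @dominated_convergence _ _ _ P setT measurableT
  (fun K w => (clip K%:R (neglog (p (X1n n w))))%:E) (fun w => neglog (p (X1n n w)))
  (fun w => `|neglog (p (X1n n w))|%E) => //.
- move=> K; apply/measurable_EFinP.
  exact: measurableT_comp (@measurable_clip R K%:R) mnp.
- apply: filterS fin => w /(_ I); case: (neglog _) => // r _ _ /=.
  apply: cvg_near_cst; near=> K; rewrite clip_EFin//.
  by near: K; exact: nbhs_infty_ger.
- exact: integrable_abse ip.
- apply: filterS fin => w /(_ I); case: (neglog _) => // r _ K _ /=.
  by rewrite lee_fin normr_clip_le.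
Unshelve. all: by end_near. Qed.

(** For the test function [ln p_n] the Donsker-Varadhan bound would be the mean of [- ln p_n], as
    [p_n] has integral 1. Here [Phi] approximates this function after clipping. *)
Lemma quantized_entropy_approx (eps : R) : 0 < eps ->
  exists l, block_entropy (quantized P (@measurable_cell l)) n +
    \sum_(a : n.-tuple 'I_(k l).+1)
      cylinder_prob (quantized P (@measurable_cell l)) a * ln (box_mass mu (cell l) a) <=
    fine (\int[P]_w neglog (p (X1n n w)))%E + eps.
Proof.
move=> e0; set I := (\int[P]_w _)%E.
have Ifin : I \is a fin_num by exact: integrable_fin_num.
pose M := fine (mupow mu n setT); have M0 : 0 <= M by exact: fine_ge0.
have ME : mupow mu n setT = M%:E by rewrite fineK// fin_num_measure.
have e4 : 0 < eps / 4 by rewrite divr_gt0.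
(* [K] keeps two errors small: the change in the mean of [- ln p_n], and the mass [M * exp(- K)]
   that clipping adds to the exponential sum. *)
have [K [HK1 HK2]] : exists K : nat,
    (\int[P]_w (clip K%:R (neglog (p (X1n n w))))%:E < (fine I + eps / 4)%:E)%E /\
    M * expR (- K%:R) <= eps / 4.
  have h1 : \forall K \near \oo,
      (\int[P]_w (clip K%:R (neglog (p (X1n n w))))%:E < (fine I + eps / 4)%:E)%E.
    apply: cvge_near_lt integral_clip_cvg _.
    by rewrite -/I -{1}(fineK Ifin) lte_fin ltrDl.
  have h2 : \forall K \near \oo, M / (eps / 4) <= K%:R by exact: nbhs_infty_ger.
  have [K [hK1 hK2]] := filter_ex (filterI h1 h2); exists K; split => //.
  rewrite expRN ler_pdivrMr ?expR_gt0// mulrC -ler_pdivrMr//.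
  by apply: le_trans hK2 _; apply: le_trans (expR_ge1Dx _); rewrite lerDr.
pose v t : R := clip K%:R (neglog (p t)).
have mv : measurable_fun setT v.
  apply: measurableT_comp (@measurable_clip R K%:R) _.
  exact: measurableT_comp (@measurable_neglog R) mp.
have vK t : - K%:R <= v t <= K%:R by exact: clip_bounds.
(* A nonnegative shift of the clipped [ln p_n]; [Phi] takes the shift back. *)
pose g t := K%:R - v t.
have mg : measurable_fun setT g by exact: measurable_funB.
have gK t : 0 <= g t <= (K + K)%:R.
  by have /andP[h1 h2] := vK t; rewrite /g natrD; apply/andP; split; lra.
(* An error [eta] enters the mean of [Phi] directly and the exponential sum multiplied by the
   Lipschitz constant [exp(K)]. *)
pose eta := eps / 4 / (1 + expR K%:R).
have E1 : 0 < 1 + expR K%:R :> R by rewrite addr_gt0// expR_gt0.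
have eta0 : 0 < eta by rewrite divr_gt0.
have etaE : eta + expR K%:R * eta = eps / 4.
  by rewrite -{1}[eta]mul1r -mulrDl mulrC /eta divfK// gt_eqF.
(* One approximation must serve both terms: the law of the block controls the mean of [Phi], the
   power of [mu] the exponential sum. *)
pose lam := finite_measure_add (distribution P (@block d T n)) (mupow mu n).
have [l [phi [mphi phic phiK lphi]]] :=
  approximation_by_cell_functions Fcell lam mg gK eta0.
have [Phi0 PhiE] := same_cells_factor Fcell phic.
pose D t : R := `|g t - phi t|.
have mD : measurable_fun setT D by apply: measurableT_comp => //; exact: measurable_funB.
have D0 t : 0 <= D t by exact: normr_ge0.
have lamE : (\int[P]_w (D (X1n n w))%:E + \int[mupow mu n]_t (D t)%:E <= eta%:E)%E.
  apply: le_trans lphi; rewrite le_eqVlt; apply/orP; left; apply/eqP.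
  rewrite /lam ge0_integral_measure_add//; last exact/measurable_EFinP.
  congr (_ + _)%E; rewrite ge0_integral_distribution//; exact/measurable_EFinP.
have DP : (\int[P]_w (D (X1n n w))%:E <= eta%:E)%E.
  by apply: le_trans lamE; rewrite leeDl//; apply: integral_ge0 => t _; rewrite lee_fin.
have Dmu : (\int[mupow mu n]_t (D t)%:E <= eta%:E)%E.
  by apply: le_trans lamE; rewrite leeDr//; apply: integral_ge0 => t _; rewrite lee_fin.
exists l; pose Phi a := Phi0 a - K%:R.
have mcell := @measurable_cell l.
apply: le_trans (quantized_entropy_le mcell dp Phi) _.
have S1 : - (\sum_(a : n.-tuple 'I_(k l).+1) cylinder_prob (quantized P mcell) a * Phi a)
    <= fine I + eps / 4 + eta.
  rewrite -lee_fin -sumrN (eq_bigr (fun a : n.-tuple 'I_(k l).+1 =>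
    cylinder_prob (quantized P mcell) a * - Phi a)); last by move=> a _; rewrite mulrN.
  have mbox (a : n.-tuple 'I_(k l).+1) : measurable [set w : Xpath T | map_tuple (cell l) (X1n n w) = a].
    have := @measurable_X1n d T n measurableT _ (measurable_box mcell a).
    by rewrite setTI.
  have -> : ((\sum_(a : n.-tuple 'I_(k l).+1) cylinder_prob (quantized P mcell) a * - Phi a)%:E =
      \int[P]_w (- Phi (map_tuple (cell l) (X1n n w)))%:E)%E.
    rewrite (expectation_finite_valued P mbox (fun a => - Phi a)).
    by congr EFin; apply: eq_bigr => a _; rewrite cylinder_probE cylP_quantized.
  have mDX : measurable_fun setT (fun w : Xpath T => (D (X1n n w))%:E).
    exact: (measurable_fun_X1n (g := EFin \o D)) (measurableT_comp _ mD).
  have iv : P.-integrable setT (fun w => (v (X1n n w))%:E).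
    apply: (@measurable_bounded_integrable _ _ _ P (fun w => v (X1n n w))) => //.
    - by rewrite [X in (X < _)%E]probability_setT ltry.
    - exact: measurableT_comp mv (@measurable_X1n d T n).
    - exists K%:R; split => // x Kx w _; apply: le_trans (ltW Kx).
      by rewrite ler_norml; exact: vK.
  have iD : P.-integrable setT (fun w => (D (X1n n w))%:E).
    apply: fin_num_integrable => //; rewrite ge0_fin_numE ?(le_lt_trans DP) ?ltry//.
    by apply: integral_ge0 => w _; rewrite lee_fin.
  apply: (@le_trans _ _ (\int[P]_w ((v (X1n n w))%:E + (D (X1n n w))%:E))%E).
    apply: le_integral_ae.
    - by apply/measurable_EFinP; exact: (measurable_finite_valued mbox (fun a => - Phi a)).
    - by apply: emeasurable_funD => //; exact: measurable_int iv.
    apply: aeW => w; rewrite -EFinD lee_fin /Phi -PhiE /D.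
    have := ler_norm (g (X1n n w) - phi (X1n n w)).
    by rewrite /g; lra.
  rewrite integralD// EFinD; exact: leeD (ltW HK1) DP.
have S2 : ln (\sum_(a : n.-tuple 'I_(k l).+1) box_mass mu (cell l) a * expR (Phi a)) <=
    M * expR (- K%:R) + expR K%:R * eta.
  set Z := \sum_(a : n.-tuple _) _.
  have rhs0 : 0 <= M * expR (- K%:R) + expR K%:R * eta.
    by rewrite addr_ge0// mulr_ge0 ?expR_ge0// ltW.
  (* Pointwise [exp(Phi)] is at most [exp(- v) + exp(K) * D], and [exp(- v)] is at most
     [p + exp(- K)]; then [p] integrates to 1. *)
  have ZE : Z <= 1 + (M * expR (- K%:R) + expR K%:R * eta).
    rewrite -lee_fin /Z -(integral_mupow_cells mu mcell (fun a => expR (Phi a))).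
    apply: (@le_trans _ _ (\int[mupow mu n]_t ((p t + (expR (- K%:R))%:E) + (expR K%:R)%:E * (D t)%:E))%E).
      apply: ge0_le_integral => //.
      - by apply/measurable_EFinP; exact: (measurable_fun_cells mcell (fun a => expR (Phi a))).
      - apply: emeasurable_funD; first exact: emeasurable_funD.
        by apply: emeasurable_funM => //; exact/measurable_EFinP.
      move=> t _; rewrite /Phi -PhiE.
      apply: (@le_trans _ _ ((expR (- v t))%:E + (expR K%:R * D t)%:E)%E); last first.
        by apply: leeD => //; exact: expR_clip_neglog.
      rewrite -EFinD lee_fin; have /andP[_ phK] := phiK t; rewrite natrD in phK.
      have aK : phi t - K%:R <= K%:R by lra.
      apply: le_trans (expR_le_lipschitz (- v t) aK) _.
      rewrite lerD2l ler_wpM2l ?expR_ge0// /D le_eqVlt; apply/orP; left; apply/eqP.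
      by congr `|_|; rewrite /g; lra.
    have ge1 t : (0 <= p t + (expR (- K%:R))%:E)%E by rewrite adde_ge0// lee_fin ?expR_ge0.
    have ge2 t : (0 <= (expR K%:R)%:E * (D t)%:E)%E by rewrite mule_ge0// lee_fin ?expR_ge0.
    have ge3 : (0 <= (expR (- K%:R : R))%:E)%E by rewrite lee_fin expR_ge0.
    have m1 : measurable_fun setT (fun t => p t + (expR (- K%:R))%:E)%E by exact: emeasurable_funD.
    have m2 : measurable_fun setT (fun t => (expR K%:R)%:E * (D t)%:E)%E.
      by apply: emeasurable_funM => //; exact/measurable_EFinP.
    rewrite ge0_integralD// ge0_integralD//.
    rewrite (integral_density_eq1 dp) integral_cst// [X in (_ + _ * X)%E]ME.
    rewrite EFinD EFinD -addeA; apply: leeD => //; apply: leeD.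
      by rewrite -EFinM mulrC.
    rewrite ge0_integralZl_EFin ?expR_ge0//; [|by move=> t _; rewrite lee_fin|exact/measurable_EFinP].
    by rewrite EFinM lee_wpmul2l// lee_fin expR_ge0.
  have [Z0|Z0] := leP Z 0; first by rewrite ln0.
  have := @le_ln1Dx R (Z - 1); rewrite addrCA subrr addr0 => H.
  by apply: le_trans (H _) _; lra.
by lra.
Qed.

End quantization.

(** * The NPD density *)

Section npd.
Context (R : realType) d (T : measurableType d) (mu : {finite_measure set T -> \bar R}).
Context (k : nat -> nat) (cell : forall l, T -> 'I_(k l).+1).
Hypothesis mcell : forall l a, measurable (cell l @^-1` [set a]).
Context (Rl : forall l, probability (apath (k l)) R).

Lemma NPDlE l n (x : n.-tuple T) : NPDl mu k cell Rl l x =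
  cylinder_prob (Rl l) (map_tuple (cell l) x) / box_mass mu (cell l) (map_tuple (cell l) x).
Proof.
rewrite /NPDl cylinder_probE; congr (_ / _); apply: eq_bigr => i _.
by rewrite /cell_mass tnth_map.
Qed.

Lemma NPDl_ge0 l n (x : n.-tuple T) : 0 <= NPDl mu k cell Rl l x.
Proof. by rewrite NPDlE divr_ge0 ?cylinder_prob_ge0 ?box_mass_ge0. Qed.

Lemma measurable_NPDl l n : measurable_fun setT (fun x : n.-tuple T => NPDl mu k cell Rl l x).
Proof.
rewrite (funext (@NPDlE l n)).
exact: (measurable_fun_cells (@mcell l) (fun a : n.-tuple 'I_(k l).+1 =>
  cylinder_prob (Rl l) a / box_mass mu (cell l) a)).
Qed.

(** [Rl l] may charge boxes of [mu]-mass zero, where the quotient takes the default value 0 and this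
    probability is lost. *)
Lemma integral_NPDl_le1 l n : (\int[mupow mu n]_x (NPDl mu k cell Rl l x)%:E <= 1)%E.
Proof.
under eq_integral do rewrite NPDlE.
rewrite (integral_mupow_cells mu (@mcell l) (fun a : n.-tuple 'I_(k l).+1 =>
  cylinder_prob (Rl l) a / box_mass mu (cell l) a)) lee_fin.
rewrite -(sum_cylinder_prob (Rl l) n); apply: ler_sum => a _.
have [->|b0] := eqVneq (box_mass mu (cell l) a) 0; first by rewrite mul0r cylinder_prob_ge0.
by rewrite mulrCA divff// mulr1.
Qed.

Lemma wNPD_gt0 l : 0 < wNPD R l.
Proof. by rewrite subr_gt0 ltf_pV2 ?posrE// ltr_nat. Qed.

Lemma sum_wNPD_le1 n : \sum_(0 <= l < n) wNPD R l <= 1.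
Proof.
have -> : \sum_(0 <= l < n) wNPD R l = 1 - n.+1%:R^-1.
  elim: n => [|n IH]; first by rewrite big_nil invr1 subrr.
  by rewrite big_nat_recr//= IH /wNPD addrA subrK.
by rewrite gerBl invr_ge0.
Qed.

Let term_ge0 n (x : n.-tuple T) l : (0 <= (wNPD R l * NPDl mu k cell Rl l x)%:E)%E.
Proof. by rewrite lee_fin mulr_ge0 ?NPDl_ge0// ltW// wNPD_gt0. Qed.

Lemma NPD_ge0 n (x : n.-tuple T) : (0 <= NPD mu k cell Rl x)%E.
Proof. exact: nneseries_ge0. Qed.

Lemma measurable_NPD n : measurable_fun setT (fun x : n.-tuple T => NPD mu k cell Rl x).
Proof.
apply: ge0_emeasurable_sum => // l _; apply/measurable_EFinP.
by apply: measurable_funM => //; exact: measurable_NPDl.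
Qed.

Lemma integral_NPD_le1 n : (\int[mupow mu n]_x NPD mu k cell Rl x <= 1)%E.
Proof.
rewrite integral_nneseries//; last first.
  by move=> l; apply/measurable_EFinP; apply: measurable_funM => //; exact: measurable_NPDl.
apply: (@le_trans _ _ (\sum_(0 <= l <oo) (wNPD R l)%:E)%E).
  apply: lee_nneseries => [l _ _|l _]; first exact: integral_ge0.
  under eq_integral do rewrite EFinM.
  rewrite ge0_integralZl_EFin//; last 3 first.
  - by move=> x _; rewrite lee_fin NPDl_ge0.
  - by apply/measurable_EFinP; exact: measurable_NPDl.
  - by rewrite ltW// wNPD_gt0.
  rewrite -[leRHS]mule1 lee_wpmul2l ?integral_NPDl_le1//.
  by rewrite lee_fin ltW// wNPD_gt0.
apply: lime_le; first by apply: is_cvg_nneseries => l _ _; rewrite lee_fin ltW// wNPD_gt0.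
by apply: nearW => n'; rewrite sumEFin lee_fin sum_wNPD_le1.
Qed.

Lemma NPDl_le_NPD l n (x : n.-tuple T) :
  ((wNPD R l * NPDl mu k cell Rl l x)%:E <= NPD mu k cell Rl x)%E.
Proof.
apply: le_trans (nneseries_lim_ge l.+1 _) => //.
by rewrite big_nat_recr//= leeDr//; apply: sume_ge0.
Qed.

Definition NPDseq (s : seq T) : \bar R := NPD mu k cell Rl (in_tuple s).

Lemma NPDseqE n (x : n.-tuple T) : NPDseq x = NPD mu k cell Rl x.
Proof.
rewrite /NPDseq; case: x => s sn /=; have e := eqP sn; subst n.
by congr (NPD _ _ _ _ _); exact/val_inj.
Qed.

Lemma seq_measurable_NPDseq : seq_measurable NPDseq.
Proof. by move=> n; rewrite (funext (@NPDseqE n)); exact: measurable_NPD. Qed.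

Lemma integral_NPDseq_le1 n : (\int[mupow mu n]_x NPDseq x <= 1)%E.
Proof. by under eq_integral do rewrite NPDseqE; exact: integral_NPD_le1. Qed.

End npd.

Lemma cvge_squeeze_eps (R : realType) (u : nat -> \bar R) (h : R) :
  (forall eps : R, 0 < eps -> \forall n \near \oo, ((h - eps)%:E <= u n <= (h + eps)%:E)%E) ->
  u n @[n --> \oo] --> h%:E.
Proof.
move=> H; apply/fine_cvgP; split.
  apply: filterS (H 1 ltr01) => n /andP[h1 h2].
  by rewrite fin_real// (lt_le_trans _ h1) ?ltNyr// (le_lt_trans h2) ?ltry.
apply/cvgrPdist_le => eps e0; apply: filterS (H eps e0) => n /=.
case: (u n) => [r| |]; rewrite ?lee_fin.
- by move=> /andP[h1 h2]; rewrite /= ler_norml; apply/andP; split; lra.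
- by rewrite leye_eq andbF.
- by rewrite leeNy_eq.
Qed.

(** Dominated convergence for the indicators of the deviation events. *)
Lemma conv_as_prob (R : realType) d (S : measurableType d) (Q : probability S R)
    (f : nat -> S -> \bar R) (h : R) :
  (forall n, measurable_fun setT (f n)) -> conv_as Q f h -> conv_prob Q f h.
Proof.
move=> mf as_h eps e0.
pose A n : set S := [set w | (eps%:E <= `|f n w - h%:E|)%E].
have mA n : measurable (A n).
  rewrite (_ : A n = (fun w => `|f n w - h%:E|%E) @^-1` `[eps%:E, +oo[).
    rewrite -[X in measurable X]setTI.
    have mF : measurable_fun setT (fun w => `|f n w - h%:E|%E).
      by apply: measurableT_comp => //; exact: emeasurable_funB.
    by apply: mF => //; exact: emeasurable_itv.
  by apply/seteqP; split => w /=; rewrite /A/= in_itv/= ?andbT.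
have E n : (\int[Q]_w (\1_(A n) w)%:E = Q (A n))%E by rewrite integral_indic// setIT.
have [|||||_ _] := @dominated_convergence _ _ _ Q setT measurableT
  (fun n w => (\1_(A n) w)%:E) (cst 0%E) (fun=> 1%:E).
- by move=> n; exact/measurable_EFinP.
- exact: measurable_cst.
- apply: filterS as_h => w cv _; apply: cvg_near_cst.
  have n1 : \forall n \near \oo, (f n w < (h + eps)%:E)%E.
    by apply: cvge_near_lt cv _; rewrite lte_fin ltrDl.
  have n2 : \forall n \near \oo, ((h - eps)%:E < f n w)%E.
    by apply: cvge_near_gt cv _; rewrite lte_fin gtrBl.
  apply: filterS2 n1 n2 => n h1 h2; rewrite indicE memNset// /A /=.
  apply/negP; rewrite -ltNge; move: h1 h2; case: (f n w) => // r.
  by rewrite !lte_fin => h1 h2; rewrite ltr_norml; apply/andP; split; lra.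
- exact: finite_measure_integrable_cst.
- by apply: aeW => w n _; rewrite gee0_abs ?lee_fin// indicE; case: (_ \in _).
rewrite integral0; apply: cvg_trans.
by apply: near_eq_cvg; apply: nearW => n; rewrite /= -E.
Qed.

(** * Entropy rates and NPD bounds at a fixed level *)

Section quantized_rate.
Context (R : realType) d (T : measurableType d) (mu : {finite_measure set T -> \bar R}).
Context (k : nat -> nat) (cell : forall l, T -> 'I_(k l).+1).
Hypothesis Fcell : finite_filtration cell.
Context (P : probability (Xpath T) R) (p : forall n, n.-tuple T -> \bar R) (h : R).
Hypothesis EP : in_E_mu mu P p h.

Let stP : stationary P. Proof. by case: EP. Qed.
Let ergP : ergodic P. Proof. by case: EP. Qed.

Definition mean_ln_cell l : R :=
  \sum_(a : 'I_(k l).+1) fine (P [set w : Xpath T | cell l (w 1) = a]) * ln (cell_mass mu (cell l) a).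

(** Choose [n] with nearly optimal mean, then [l] for this [n]. [H] is at most the block entropy per
    letter, and the mean of the logarithmic box mass is exactly [n * mean_ln_cell l], so the
    estimate at [n] passes to the rate. *)
Lemma quantized_rate_approx (eps : R) : 0 < eps ->
  exists l H, entropy_rate (quantized P (measurable_cell Fcell (l := l))) H /\
    H + mean_ln_cell l <= h + eps.
Proof.
move=> e0; have e2 : 0 < eps / 2 by rewrite divr_gt0.
case: (EP) => _ _ _ cv.
have h1 : \forall n \near \oo,
    ((n%:R)^-1%:E * \int[P]_w neglog (p (X1n n w)) < (h + eps / 2)%:E)%E.
  by apply: cvge_near_lt cv _; rewrite lte_fin ltrDl.
have [n [n0 [hn ip]]] := filter_ex (filterI (nbhs_infty_gt 0) (filterI h1 (E_mu_integrable EP))).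
have [l Hl] := quantized_entropy_approx Fcell (E_mu_density EP n) ip e2.
have stQ := stationary_quantized (measurable_cell Fcell (l := l)) stP.
have [H [HH Hle]] := entropy_rate_exists stQ.
exists l, H; split => //.
have n0' : 0 < n%:R :> R by rewrite ltr0n.
rewrite (expectation_ln_box_mass _ stP (E_mu_density EP n)) -/(mean_ln_cell l) in Hl.
have := Hle n n0; rewrite ler_pdivlMl// => {}Hle.
have Ifin : (\int[P]_w neglog (p (X1n n w)))%E \is a fin_num by exact: integrable_fin_num.
move: hn; rewrite -(fineK Ifin) -EFinM lte_fin ltr_pdivrMl// => hn.
have n1 : 1 <= n%:R :> R by rewrite ler1n.
rewrite -(ler_pM2l n0').
have : eps / 2 <= n%:R * (eps / 2) by rewrite ler_peMl// ltW.
by rewrite !mulrDr in hn *; lra.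
Qed.

Section level.
Variables (l : nat).
Let mcell := measurable_cell Fcell (l := l).
Let Q : probability (apath (k l)) R := quantized P mcell.

Lemma ae_quantized (S : apath (k l) -> Prop) :
  {ae Q, forall y, S y} -> {ae P, forall w, S (quantize (cell l) w)}.
Proof.
move=> [N [mN N0 SN]]; exists (quantize (cell l) @^-1` N); split => //.
  by rewrite -[X in measurable X]setTI; exact: measurable_quantize.
by move=> w /= nS; apply: SN.
Qed.

Lemma ae_box_mass_gt0 n :
  {ae P, forall w : Xpath T, 0 < box_mass mu (cell l) (map_tuple (cell l) (X1n n w))}.
Proof.
suff /ae_quantized : {ae Q, forall y, 0 < box_mass mu (cell l) (X1n n y)}.
  by apply: filterS => w; rewrite X1n_quantize.
(* [F] is the indicator of the boxes of mass zero; none of them has positive probability. *)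
pose F (a : n.-tuple 'I_(k l).+1) : R := (box_mass mu (cell l) a <= 0)%R%:R.
have I0 : (\int[Q]_y `|(F (X1n n y))%:E| = 0)%E.
  under eq_integral do rewrite gee0_abs ?lee_fin ?ler0n//.
  rewrite (expectation_block Q F) big1// => a _.
  have := cylinder_prob_ge0 Q a; rewrite le_eqVlt => /predU1P[<-|]; first by rewrite mul0r.
  move=> /(box_mass_gt0 (E_mu_density EP n)) b0.
  by rewrite /F leNgt b0 mulr0.
have mF : measurable_fun setT (fun y : apath (k l) => (F (X1n n y))%:E).
  apply/measurable_EFinP.
  exact: (measurable_finite_valued (@measurable_cylinder (k l) n) F).
have /(ae_eq_integral_abs _ measurableT mF) := I0.
apply: filterS => y /(_ I) /= -[]; rewrite /F; case: leP => // _ /eqP.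
by rewrite oner_eq0.
Qed.

End level.

End quantized_rate.

Lemma ae_and d (T : measurableType d) (R : realType) (m : {measure set T -> \bar R}) (A B : T -> Prop) :
  {ae m, forall x, A x} -> {ae m, forall x, B x} -> {ae m, forall x, A x /\ B x}.
Proof. exact: filterS2. Qed.

Lemma neglog_le (R : realType) (x y : \bar R) : (0 <= x)%E -> (x <= y)%E ->
  (neglog y <= neglog x)%E.
Proof.
case: x => [r| |]//; case: y => [s| |]//=; rewrite ?leNye// !lee_fin => r0 rs.
have [_|rn0] := eqVneq r 0; first by rewrite leey.
have r1 : 0 < r by rewrite lt_neqAle eq_sym rn0.
have s1 := lt_le_trans r1 rs.
by rewrite gt_eqF// lee_fin lerN2 ler_ln.
Qed.

Section neglog_cylinder.
Context (R : realType) (m : nat) (Q : probability (apath m) R).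

Lemma cylP_EFin n (a : n.-tuple 'I_m.+1) : cylP Q a = (cylinder_prob Q a)%:E.
Proof. by rewrite cylinder_probE fineK// fin_num_measure//; exact: measurable_cylinder. Qed.

Lemma neglog_cylP_ge0 n (a : n.-tuple 'I_m.+1) : (0 <= neglog (cylP Q a))%E.
Proof.
rewrite cylP_EFin /=; case: ifPn => [_|c0]; first by rewrite leey.
by rewrite lee_fin oppr_ge0 ln_le0// cylinder_prob_le1.
Qed.

Lemma measurable_neglog_cylP n :
  measurable_fun setT (fun y : apath m => neglog (cylP Q (X1n n y))).
Proof.
rewrite (_ : (fun y => _) = fun y : apath m => neglog (cylinder_prob Q (X1n n y))%:E); last first.
  by apply/funext => y; rewrite cylP_EFin.
apply: measurableT_comp; first exact: measurable_neglog.
apply/measurable_EFinP.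
exact: (measurable_finite_valued (@measurable_cylinder m n) (fun a => cylinder_prob Q a)).
Qed.

End neglog_cylinder.

Section level_bounds.
Context (R : realType) d (T : measurableType d) (mu : {finite_measure set T -> \bar R}).
Context (k : nat -> nat) (cell : forall l, T -> 'I_(k l).+1).
Hypothesis Fcell : finite_filtration cell.
Context (P : probability (Xpath T) R) (p : forall n, n.-tuple T -> \bar R) (h : R).
Hypothesis EP : in_E_mu mu P p h.
Context (Rl : forall l, probability (apath (k l)) R).
Variables (l : nat) (H : R).
Let mcell := measurable_cell Fcell (l := l).
Let Q : probability (apath (k l)) R := quantized P mcell.
Hypothesis HU : universal_alphabet (Rl l).
Hypothesis QH : entropy_rate Q H.

Let stP : stationary P. Proof. by case: EP. Qed.
Let ergP : ergodic P. Proof. by case: EP. Qed.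

Let code n (w : Xpath T) : \bar R := cylP (Rl l) (X1n n (quantize (cell l) w)).
Let box n (w : Xpath T) : R := box_mass mu (cell l) (map_tuple (cell l) (X1n n w)).
Let e := mean_ln_cell mu cell P l.

Let codeE n w : code n w = (cylinder_prob (Rl l) (map_tuple (cell l) (X1n n w)))%:E.
Proof.
rewrite cylinder_probE fineK /code ?X1n_quantize// fin_num_measure//.
exact: measurable_cylinder.
Qed.

Lemma neglog_NPD_le n w : 0 < box n w ->
  (neglog (NPD mu k cell Rl (X1n n w)) <=
    (- ln (wNPD R l) + ln (box n w))%:E + neglog (code n w))%E.
Proof.
move=> b0; have w0 := wNPD_gt0 R l.
have r0 := cylinder_prob_ge0 (Rl l) (map_tuple (cell l) (X1n n w)).
apply: le_trans (neglog_le _ (NPDl_le_NPD mu cell Rl l (X1n n w))) _.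
  by rewrite lee_fin mulr_ge0 ?NPDl_ge0// ltW.
rewrite NPDlE codeE /=; move: r0; rewrite le_eqVlt => /predU1P[<-|r0].
  by rewrite eqxx mul0r mulr0 eqxx leey.
rewrite !gt_eqF ?mulr_gt0 ?invr_gt0//.
rewrite -EFinD lee_fin lnM ?posrE ?mulr_gt0 ?invr_gt0// ln_div ?posrE// /box.
by lra.
Qed.

Lemma ae_ln_box_le eps : 0 < eps ->
  {ae P, forall w, \forall n \near \oo, ln (box n w) <= n%:R * (e + eps)}.
Proof.
(* Adding [B] makes the logarithmic cell masses nonnegative, as the covering argument requires; it
   cancels at the end. *)
move=> e0; pose B := \sum_(a : 'I_(k l).+1) `|ln (cell_mass mu (cell l) a)|.
have B0 : 0 <= B by apply: sumr_ge0.
have lnB a : `|ln (cell_mass mu (cell l) a)| <= B by rewrite /B (bigD1 a)//= lerDl sumr_ge0.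
pose f (w : Xpath T) : R := ln (cell_mass mu (cell l) (cell l (w 1))) + B.
have m1 (a : 'I_(k l).+1) : measurable [set w : Xpath T | cell l (w 1) = a].
  exact: (@measurable_coord T measurable 1 (cell l @^-1` [set a]) (mcell a)).
have mf : measurable_fun setT f.
  exact: (measurable_finite_valued m1 (fun a => ln (cell_mass mu (cell l) a) + B)).
have fB w : 0 <= f w <= B + B.
  by have := lnB (cell l (w 1)); rewrite ler_norml => /andP[? ?]; apply/andP; split; rewrite /f; lra.
have Ef : (\int[P]_w (f w)%:E = (e + B)%:E)%E.
  rewrite (expectation_finite_valued P m1 (fun a => ln (cell_mass mu (cell l) a) + B)).
  congr EFin; under eq_bigr do rewrite mulrDr.
  by rewrite big_split/= -mulr_suml (sum_finite_valued P m1) mul1r.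
have HB := birkhoff_limsup stP ergP mf fB Ef e0.
have hb : {ae P, forall w, forall n, 0 < box n w}.
  by apply: ae_foralln => n; exact: (ae_box_mass_gt0 Fcell EP l n).
apply: filterS (ae_and HB hb) => w [+ bw]; apply: filterS => n Hn.
have -> : ln (box n w) = \sum_(i < n) (f (iter i (@shift T) w) - B).
  have := bw n; rewrite /box /box_mass; elim/big_rec2: _ => [_|i y z _ IH]; first by rewrite ln1.
  have := cell_mass_ge0 mu (cell l) (tnth (map_tuple (cell l) (X1n n w)) i).
  rewrite le_eqVlt => /predU1P[<-|c0]; first by rewrite mul0r ltxx.
  rewrite pmulr_rgt0// => z0; rewrite -IH// lnM//.
  by rewrite /f addrK iter_shiftE tnth_map tnth_X1n.
rewrite sumrB sumr_const card_ord -[B *+ n]mulr_natl.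
by move: Hn; rewrite !mulrDr; lra.
Qed.

Lemma ae_nlog_NPD_le eps : 0 < eps ->
  {ae P, forall w, \forall n \near \oo,
    (nlog n (NPD mu k cell Rl (X1n n w)) <= (H + e + eps)%:E)%E}.
Proof.
(* The thirds of [eps] go to the code length of [Rl l], to the logarithmic box mass, and to the
   constant [- ln (wNPD R l)], which is negligible after division by [n]. *)
move=> e0; have e3 : 0 < eps / 3 by rewrite divr_gt0.
have [as_conv _ _] := HU (stationary_quantized mcell stP) (ergodic_quantized mcell ergP) QH.
have := ae_quantized as_conv => {}as_conv.
have hb : {ae P, forall w, forall n, 0 < box n w}.
  by apply: ae_foralln => n; exact: (ae_box_mass_gt0 Fcell EP l n).
have h3 := ae_and as_conv (ae_and (ae_ln_box_le e3) hb).
apply: filterS h3 => w [cv [lnb bw]].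
have cv' : \forall n \near \oo, (nlog n (code n w) < (H + eps / 3)%:E)%E.
  by apply: cvge_near_lt cv _; rewrite lte_fin ltrDl.
have cw : \forall n \near \oo, - ln (wNPD R l) / (eps / 3) <= n%:R.
  exact: nbhs_infty_ger.
near=> n.
have n0 : 0 < n%:R :> R by rewrite ltr0n; near: n; exact: nbhs_infty_gt.
have H1 : (nlog n (code n w) < (H + eps / 3)%:E)%E by near: n.
have H2 : ln (box n w) <= n%:R * (e + eps / 3) by near: n.
have H3 : - ln (wNPD R l) / (eps / 3) <= n%:R by near: n.
move: H3; rewrite ler_pdivrMr// => H3.
rewrite /nlog lee_pdivrMl//; apply: le_trans (neglog_NPD_le (bw n)) _.
move: H1; rewrite /nlog lte_pdivrMl//; case: (neglog _) => [r| |]//=.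
  rewrite -!EFinM lte_fin -EFinD lee_fin => H1.
  by move: H1 H2; rewrite !mulrDr; lra.
by rewrite addeNy leNye.
Unshelve. all: by end_near. Qed.

Lemma integral_neglog_code n :
  (\int[P]_w neglog (code n w) = \int[Q]_y neglog (cylP (Rl l) (X1n n y)))%E.
Proof.
have := @ge0_integral_pushforward _ _ _ _ _ _ (measurable_quantize mcell) P setT _ measurableT
  (@measurable_neglog_cylP R (k l) (Rl l) n).
by rewrite preimage_setT => <- // y _; exact: neglog_cylP_ge0.
Qed.

(** Universality in mean replaces the almost sure one, and the mean of the logarithmic box mass is
    exactly [n * e]. *)
Lemma integral_neglog_NPD_le eps : 0 < eps ->
  \forall n \near \oo, (\int[P]_w neglog (NPD mu k cell Rl (X1n n w)) <=
     (n%:R * (H + e + eps))%:E)%E.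
Proof.
move=> e0; have e2 : 0 < eps / 2 by rewrite divr_gt0.
have [_ ex_conv _] := HU (stationary_quantized mcell stP) (ergodic_quantized mcell ergP) QH.
have cv : \forall n \near \oo,
    (\int[Q]_y nlog n (cylP (Rl l) (X1n n y)) < (H + eps / 2)%:E)%E.
  by apply: cvge_near_lt ex_conv _; rewrite lte_fin ltrDl.
near=> n.
have n0 : 0 < n%:R :> R by rewrite ltr0n; near: n; exact: nbhs_infty_gt.
have cw : - ln (wNPD R l) / (eps / 2) <= n%:R by near: n; exact: nbhs_infty_ger.
move: cw; rewrite ler_pdivrMr// => cw.
have : (\int[Q]_y nlog n (cylP (Rl l) (X1n n y)) < (H + eps / 2)%:E)%E by near: n.
rewrite /nlog ge0_integralZl_EFin//; last 2 first.
- by move=> y _; exact: neglog_cylP_ge0.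
- exact: (@measurable_neglog_cylP R (k l) (Rl l) n).
rewrite lte_pdivrMl// -integral_neglog_code => Hv.
have v0 : (0 <= \int[P]_w neglog (code n w))%E by apply: integral_ge0 => w _; exact: neglog_cylP_ge0.
have mcode : measurable_fun setT (fun w : Xpath T => neglog (code n w)).
  exact: (measurableT_comp (@measurable_neglog_cylP R (k l) (Rl l) n) (measurable_quantize mcell)).
have ic : P.-integrable setT (fun w => neglog (code n w)).
  by apply: fin_num_integrable => //; rewrite ge0_fin_numE// (lt_trans Hv)// ltry.
have mbox (a : n.-tuple 'I_(k l).+1) : measurable [set w : Xpath T | map_tuple (cell l) (X1n n w) = a].
  have := @measurable_X1n d T n measurableT _ (measurable_box mcell a).
  by rewrite setTI.
pose F (a : n.-tuple 'I_(k l).+1) := - ln (wNPD R l) + ln (box_mass mu (cell l) a).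
have ib := integrable_finite_valued P mbox F.
apply: (@le_trans _ _ (\int[P]_w ((F (map_tuple (cell l) (X1n n w)))%:E + neglog (code n w)))%E).
  apply: le_integral_ae.
  - apply: (measurable_fun_X1n (g := fun t => neglog (NPD mu k cell Rl t))).
    by apply: measurableT_comp (@measurable_neglog R) _;
      exact: (measurable_NPD mu (fun l => measurable_cell Fcell (l := l))).
  - by apply: emeasurable_funD => //; exact: measurable_int ib.
  apply: filterS (ae_box_mass_gt0 Fcell EP l n) => w bw.
  exact: neglog_NPD_le.
rewrite integralD// (expectation_finite_valued P mbox F).
have -> : \sum_(a : n.-tuple 'I_(k l).+1) fine (P [set w : Xpath T | map_tuple (cell l) (X1n n w) = a]) * F a =
    - ln (wNPD R l) + n%:R * e.
  under eq_bigr do rewrite mulrDr.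
  rewrite big_split/= -mulr_suml (sum_finite_valued P mbox) mul1r; congr (_ + _).
  rewrite -(expectation_ln_box_mass mcell stP (E_mu_density EP n)); apply: eq_bigr => a _.
  by rewrite cylinder_probE cylP_quantized.
apply: le_trans (leeD (lexx _) (ltW Hv)) _.
by rewrite -EFinM -EFinD lee_fin !mulrDr; lra.
Unshelve. all: by end_near. Qed.

End level_bounds.

(** * Universality of the NPD measure *)

Lemma ae_imp d (T : measurableType d) (R : realType) (m : {measure set T -> \bar R}) (A B : T -> Prop) :
  (forall x, A x -> B x) -> {ae m, forall x, A x} -> {ae m, forall x, B x}.
Proof. by move=> AB; exact: filterS. Qed.

Theorem mainTheorem4 (R : realType) (d : measure_display) (T : measurableType d)
  (mu : {finite_measure set T -> \bar R})
  (k : nat -> nat) (cell : forall l, T -> 'I_(k l).+1)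
  (Rl : forall l, probability (apath (k l)) R) :
  finite_filtration cell ->
  (forall l, universal_alphabet (Rl l)) ->
  forall (P : probability (Xpath T) R) (p : forall n, n.-tuple T -> \bar R) (h : R),
    in_E_mu mu P p h ->
    let f := fun n (w : Xpath T) => nlog n (NPD mu k cell Rl (X1n n w)) in
    [/\ conv_as P f h, conv_exp P f h & conv_prob P f h].
Proof.
move=> Fcell HU P p h EP f.
have mcell := fun l => measurable_cell Fcell (l := l).
have mf n : measurable_fun setT (fun w : Xpath T => neglog (NPD mu k cell Rl (X1n n w))).
  apply: (measurable_fun_X1n (g := fun t => neglog (NPD mu k cell Rl t))).
  apply: measurableT_comp; first exact: measurable_neglog.
  exact: measurable_NPD.
have NPDseq_ge0 s : (0 <= NPDseq mu cell Rl s)%E by exact: NPD_ge0.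
have upper (eps : R) : 0 < eps -> exists l H,
    entropy_rate (quantized P (measurable_cell Fcell (l := l))) H /\ H + mean_ln_cell mu cell P l <= h + eps.
  by move=> e0; exact: (quantized_rate_approx Fcell EP e0).
have as_upper (eps : R) : 0 < eps ->
    {ae P, forall w, \forall n \near \oo, (f n w <= (h + eps)%:E)%E}.
  move=> e0; have e2 : 0 < eps / 2 by rewrite divr_gt0.
  have [l [H [QH Hl]]] := upper _ e2.
  have := ae_nlog_NPD_le EP (HU l) QH e2.
  apply: ae_imp => w; apply: filterS => n /le_trans; apply.
  by rewrite lee_fin; lra.
have as_lower (eps : R) : 0 < eps ->
    {ae P, forall w, \forall n \near \oo, ((h - eps)%:E <= f n w)%E}.
  move=> e0; have ch : h - eps < h by rewrite gtrBl.
  have P0 := io_exceedance_null EP NPDseq_ge0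
    (seq_measurable_NPDseq mu mcell Rl) (integral_NPDseq_le1 mu mcell Rl) ch.
  exists (lim_sup_set (exceedance (NPDseq mu cell Rl) (h - eps))); split => //.
    apply: measurable_lim_sup_set => n; apply: measurable_exceedance.
    exact: seq_measurable_NPDseq.
  move=> w nE n _; apply: contrapT => H; apply: nE.
  (* Starting at [n.+1] excludes [i = 0], where the normalizing factor has the default value 0. *)
  exists n.+1 => // i /= ni; rewrite /f /nlog lee_pdivlMl ?ltr0n//; last by rewrite (leq_trans _ ni).
  have : (NPD mu k cell Rl (X1n i w) < (expR (- (i%:R * (h - eps))))%:E)%E.
    rewrite ltNge; apply/negP => Ei; apply: H; exists i => /=; first exact: ltnW.
    by move: Ei; rewrite -NPDseqE.
  move=> /ltW /(neglog_le (NPD_ge0 mu cell Rl _)) /=.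
  by rewrite gt_eqF ?expR_gt0// expRK opprK EFinM.
have as_conv : conv_as P f h.
  (* Tolerances [1 / (j + 1)] form a countable family, so the exceptional null sets unite to a null
     set. *)
  have ha : {ae P, forall w, forall j : nat,
      \forall n \near \oo, ((h - j.+1%:R^-1)%:E <= f n w <= (h + j.+1%:R^-1)%:E)%E}.
    apply: ae_foralln => j; have j0 : 0 < j.+1%:R^-1 :> R by rewrite invr_gt0.
    apply: ae_imp (ae_and (as_lower _ j0) (as_upper _ j0)) => w [h1 h2].
    by apply: filterS2 h1 h2 => n -> ->.
  apply: ae_imp ha => w H; apply: cvge_squeeze_eps => eps e0.
  pose j := Num.truncn eps^-1.
  have je : j.+1%:R^-1 <= eps.
    by rewrite -[eps]invrK lef_pV2 ?posrE ?invr_gt0// ltW// truncnS_gt.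
  apply: filterS (H j) => n /andP[h1 h2]; apply/andP; split.
    by apply: le_trans h1; rewrite lee_fin lerD2l lerN2.
  by apply: le_trans h2 _; rewrite lee_fin lerD2l.
split => //; last first.
  apply: conv_as_prob => // n; apply: emeasurable_funM => //.
apply: cvge_squeeze_eps => eps e0; have e2 : 0 < eps / 2 by rewrite divr_gt0.
have [l [H [QH Hl]]] := upper _ e2.
case: (EP) => _ _ _ cv.
have cv' : \forall n \near \oo, ((h - eps)%:E < (n%:R)^-1%:E * \int[P]_w neglog (p n (X1n n w)))%E.
  by apply: cvge_near_gt cv _; rewrite lte_fin gtrBl.
near=> n.
have n0 : 0 < n%:R :> R by rewrite ltr0n; near: n; exact: nbhs_infty_gt.
have ip : P.-integrable setT (fun w => neglog (p n (X1n n w))) by near: n; exact: E_mu_integrable EP.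
have up : (\int[P]_w neglog (NPD mu k cell Rl (X1n n w)) <=
    (n%:R * (H + mean_ln_cell mu cell P l + eps / 2))%:E)%E.
  by near: n; exact: (integral_neglog_NPD_le EP (@HU l) QH e2).
have lo := integral_neglog_le (E_mu_density EP n) (NPD_ge0 mu cell Rl (n := n))
  (@measurable_NPD _ _ _ mu _ _ mcell Rl n) (integral_NPD_le1 mu mcell Rl n) ip.
have Ifin : (\int[P]_w neglog (p n (X1n n w)))%E \is a fin_num by exact: integrable_fin_num.
(* Both bounds together make the mean finite, so that the factor [1 / n] can be taken out of the
   integral. *)
have Jfin : (\int[P]_w neglog (NPD mu k cell Rl (X1n n w)))%E \is a fin_num.
  rewrite fin_real// (le_lt_trans up) ?ltry// andbT (lt_le_trans _ lo)//.
  by rewrite ltNye_eq Ifin.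
rewrite /f /nlog integralZl//; last exact: fin_num_integrable.
apply/andP; split.
  apply: (@le_trans _ _ ((n%:R)^-1%:E * \int[P]_w neglog (p n (X1n n w)))%E).
    by apply: ltW; near: n.
  by rewrite lee_wpmul2l// lee_fin invr_ge0 ltW.
rewrite lee_pdivrMl//; apply: le_trans up _.
by rewrite -EFinM lee_fin ler_pM2l//; lra.
Unshelve. all: by end_near. Qed.
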